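(* Let $K$ be a field and let $E=((G,* ),\Omega)$ be a finite equipped graph, with $\phi:G_1\to\{0,1\}$ the characteristic function of $\Omega$. Suppose that there are no oriented cycles in $G$ on which $\phi$ is constant. Then $\mathrm{Rep}\,E$ (with its natural exact structure) has Auslander-Reiten sequences.
   Context: A quiver is a tuple $G=(G_0,G_1,h,t)$ with vertex set $G_0$, arrow set $G_1$ and head and tail maps $h,t:G_1\to G_0$. A graph is a pair $(G,* )$ where $G$ is a quiver and $*$ is a fixed-point-free involution on $G_1$ exchanging heads and tails: $(a^* )^*=a$, $a^*\ne a$, $h(a^* )=t(a)$ for $a\in G_1$. An equipped graph $E=((G,* ),\Omega)$ is a graph $(G,* )$ together with an arbitrary subset $\Omega\subseteq G_1$; its characteristic function $\phi:G_1\to\{0,1\}$ takes the value $1$ exactly on $\Omega$. It is finite if $G_0$ and $G_1$ are finite. An oriented cycle in $G$ is a cyclic word $w_0w_1\cdots w_{n-1}$, $n\ge1$ (subscripts modulo $n$), of arrows $w_i\in G_1$ with $t(w_i)=h(w_{i+1})$ for all $i$ and with no backtracking, i.e. $w_{i+1}\ne w_i^*$ for all $i$. The function $\phi$ is constant on it if all $\phi(w_i)$ are equal. A relation from a vector space $V$ to a vector space $W$ is a subspace $R\subseteq V\oplus W$; its inverse is $R^{-1}=\{(w,v):(v,w)\in R\}\subseteq W\oplus V$. Put $\mathrm{Ker}\,R=\{v\in V:(v,0)\in R\}$, $\mathrm{Def}\,R=\{v\in V:(v,w)\in R\text{ for some }w\in W\}$, $\mathrm{Ind}\,R=\{w\in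 W:(0,w)\in R\}$, $\mathrm{Im}\,R=\{w\in W:(v,w)\in R\text{ for some }v\in V\}$. For $r,s\in\{0,1\}$, $R$ is an equipped relation of type $(r,s)$ if: when $r=1$, $\mathrm{Def}\,R=V$; when $r=0$, $\mathrm{Ker}\,R=0$; when $s=1$, $\mathrm{Im}\,R=W$; when $s=0$, $\mathrm{Ind}\,R=0$. The category $\mathrm{Rep}\,E$: an object $X$ consists of a finite-dimensional $K$-vector space $X_i$ for each $i\in G_0$ and, for each $a\in G_1$, a relation $X_a\subseteq X_{t(a)}\oplus X_{h(a)}$ which is equipped of type $(\phi(a),\phi(a^* ))$, with $X_{a^*}=(X_a)^{-1}$. A morphism $\theta:X\to Y$ consists of linear maps $\theta_i:X_i\to Y_i$ for $i\in G_0$ such that $(\theta_{t(a)}(v),\theta_{h(a)}(w))\in Y_a$ for all $a\in G_1$ and $(v,w)\in X_a$. The natural exact structure on $\mathrm{Rep}\,E$: a sequence $0\to X\to Y\to Z\to0$ is exact if and only if for each $i\in G_0$ the sequence of vector spaces $0\to X_i\to Y_i\to Z_i\to0$ is exact and for each $a\in G_1$ the induced sequence $0\to X_a\to Y_a\to Z_a\to0$ is exact. Having Auslander-Reiten sequences is meant in the usual sense (Auslander–Smalø) relative to this exact structure: for every indecomposable object $Z$ that is not relatively projective there is an exact sequence $0\to X\to Y\to Z\to0$ in $\mathrm{Rep}\,E$ in which $X\to Y$ is minimal left almost split and $Y\to Z$ is minimal right almost split in $\mathrm{Rep}\,E$, and for every indecomposable object $X$ that is not relatively injective there is such a sequence starting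 at $X$. Here an object is relatively projective (respectively injective) if it is projective (respectively injective) with respect to the sequences $0\to X\to Y\to Z\to0$ in $\mathrm{Rep}\,E$ that are exact in the natural exact structure on $\mathrm{Rep}\,E$ (i.e. those for which $0\to X_i\to Y_i\to Z_i\to0$ is exact for each $i\in G_0$ and $0\to X_a\to Y_a\to Z_a\to0$ is exact for each $a\in G_1$). *)

(* Defs.v *)
From HB Require Import structures.
From mathcomp Require Import all_boot all_algebra.
Set Implicit Arguments.
Unset Strict Implicit.
Unset Printing Implicit Defensive.
Import GRing.Theory.
Local Open Scope ring_scope.

Record equippedGraph := EquippedGraph {
  vertex : finType;
  arrow : finType;
  head_of : arrow -> vertex;
  tail_of : arrow -> vertex;
  star : arrow -> arrow;
  starK : involutive star;
  star_neq : forall a, star a != a;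
  head_of_star : forall a, head_of (star a) = tail_of a;
  Omega : {set arrow}
}.

Section Graph.
Variable E : equippedGraph.

Lemma tail_of_star (a : arrow E) : tail_of (star a) = head_of a.
Proof. by rewrite -head_of_star starK. Qed.

Definition phi (a : arrow E) : bool := a \in Omega E.

Definition consecutive : rel (arrow E) :=
  fun a b => (tail_of a == head_of b) && (b != star a).

(* [cycle] also relates the last arrow of the word to the first one, so the
   predicate is invariant under rotation and can be stated on words rather
   than on cyclic words. *)
Definition oriented_cycle (w : seq (arrow E)) : bool :=
  (w != [::]) && cycle consecutive w.

Definition phi_constant (w : seq (arrow E)) : bool :=
  constant [seq phi a | a <- w].

End Graph.

Section LinearRelations.
Variable K : fieldType.

Definition linrel (V W : vectType K) := {vspace (V * W)%type}.

Section Maps.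
Variables V W : vectType K.

Definition inl_fun (v : V) : (V * W)%type := (v, 0).
Definition inr_fun (w : W) : (V * W)%type := (0, w).
Definition swap_fun (p : (V * W)%type) : (W * V)%type := (p.2, p.1).

Fact inl_fun_linear : linear inl_fun.
Proof. by move=> k u v; congr pair; rewrite /= scaler0 addr0. Qed.
Fact inr_fun_linear : linear inr_fun.
Proof. by move=> k u v; congr pair; rewrite /= scaler0 addr0. Qed.
Fact swap_fun_linear : linear swap_fun.
Proof. by []. Qed.

HB.instance Definition _ :=
  GRing.isLinear.Build K V (V * W)%type _ inl_fun inl_fun_linear.
HB.instance Definition _ :=
  GRing.isLinear.Build K W (V * W)%type _ inr_fun inr_fun_linear.
HB.instance Definition _ :=
  GRing.isLinear.Build K (V * W)%type (W * V)%type _ swap_fun swap_fun_linear.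

Definition inl_lfun : 'Hom(V, (V * W)%type) := linfun inl_fun.
Definition inr_lfun : 'Hom(W, (V * W)%type) := linfun inr_fun.
Definition swap_lfun : 'Hom((V * W)%type, (W * V)%type) := linfun swap_fun.
Definition fst_lfun : 'Hom((V * W)%type, V) := linfun fst.
Definition snd_lfun : 'Hom((V * W)%type, W) := linfun snd.

Lemma inl_lfunE v : inl_lfun v = (v, 0). Proof. exact: lfunE. Qed.
Lemma inr_lfunE w : inr_lfun w = (0, w). Proof. exact: lfunE. Qed.
Lemma swap_lfunE p : swap_lfun p = (p.2, p.1). Proof. exact: lfunE. Qed.
Lemma fst_lfunE p : fst_lfun p = p.1. Proof. exact: lfunE. Qed.
Lemma snd_lfunE p : snd_lfun p = p.2. Proof. exact: lfunE. Qed.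

Variable R : linrel V W.

Definition rel_inv : linrel W V := (swap_lfun @: R)%VS.
Definition rel_ker : {vspace V} := (inl_lfun @^-1: R)%VS.
Definition rel_def : {vspace V} := (fst_lfun @: R)%VS.
Definition rel_ind : {vspace W} := (inr_lfun @^-1: R)%VS.
Definition rel_im : {vspace W} := (snd_lfun @: R)%VS.

Lemma mem_rel_inv v w : ((w, v) \in rel_inv) = ((v, w) \in R).
Proof.
apply/memv_imgP/idP => [[[v' w'] vwR]|vwR].
  by rewrite swap_lfunE => -[-> ->].
by exists (v, w) => //; rewrite swap_lfunE.
Qed.

Lemma mem_rel_ker v : (v \in rel_ker) = ((v, 0) \in R).
Proof. by rewrite -memv_preim inl_lfunE. Qed.

Lemma mem_rel_ind w : (w \in rel_ind) = ((0, w) \in R).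
Proof. by rewrite -memv_preim inr_lfunE. Qed.

Lemma mem_rel_defP v : reflect (exists w, (v, w) \in R) (v \in rel_def).
Proof.
apply: (iffP memv_imgP) => [[[v' w] vwR ->]|[w vwR]].
  by exists w; rewrite fst_lfunE.
by exists (v, w); rewrite ?fst_lfunE.
Qed.

Lemma mem_rel_imP w : reflect (exists v, (v, w) \in R) (w \in rel_im).
Proof.
apply: (iffP memv_imgP) => [[[v w'] vwR ->]|[v vwR]].
  by exists v; rewrite snd_lfunE.
by exists (v, w); rewrite ?snd_lfunE.
Qed.

Definition equipped (r s : bool) : bool :=
  (if r then rel_def == fullv else rel_ker == 0%VS) &&
  (if s then rel_im == fullv else rel_ind == 0%VS).

End Maps.

Section PairMap.
Variables (V V' W W' : vectType K) (f : 'Hom(V, V')) (g : 'Hom(W, W')).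

Definition pair_fun (p : (V * W)%type) : (V' * W')%type := (f p.1, g p.2).

Fact pair_fun_linear : linear pair_fun.
Proof. by move=> k u v; rewrite /pair_fun /= !linearP. Qed.

HB.instance Definition _ :=
  GRing.isLinear.Build K (V * W)%type (V' * W')%type _ pair_fun pair_fun_linear.

Definition pair_lfun : 'Hom((V * W)%type, (V' * W')%type) := linfun pair_fun.

Lemma pair_lfunE p : pair_lfun p = (f p.1, g p.2).
Proof. exact: lfunE. Qed.

End PairMap.

(* Exactness of 0 -> A -> B -> C -> 0, where the maps are the restrictions of
   f and g to the subspaces A, B, C. *)
Definition short_exact (U V W : vectType K) (f : 'Hom(U, V)) (g : 'Hom(V, W))
    (A : {vspace U}) (B : {vspace V}) (C : {vspace W}) : Prop :=
  [/\ (A :&: lker f)%VS = 0%VS,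
      (f @: A)%VS = (B :&: lker g)%VS
    & (g @: B)%VS = C].

(* Transport along equalities of vertices; needed because [head_of (star a)] is
   only provably equal to [tail_of a]. *)
Definition cast_linrel (I : Type) (V : I -> vectType K) (i i' j j' : I)
    (ei : i = i') (ej : j = j') (R : linrel (V i) (V j)) :
    linrel (V i') (V j') :=
  ecast i (linrel (V i) (V j')) ei (ecast j (linrel (V i) (V j)) ej R).

End LinearRelations.

Section Rep.
Variables (K : fieldType) (E : equippedGraph).

Record rep := Rep {
  space :> vertex E -> vectType K;
  relat : forall a : arrow E, linrel (space (tail_of a)) (space (head_of a));
  relat_equipped : forall a, equipped (relat a) (phi a) (phi (star a));
  relat_star : forall a,
    cast_linrel (tail_of_star a) (head_of_star a) (relat (star a)) = rel_inv (relat a)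
}.

Record hom (X Y : rep) := Hom {
  hom_map :> forall i, 'Hom(X i, Y i);
  hom_relat : forall a v w, (v, w) \in relat X a ->
    (hom_map (tail_of a) v, hom_map (head_of a) w) \in relat Y a
}.

Definition hom_eq (X Y : rep) (f g : hom X Y) : Prop := forall i, f i = g i.

Fact idh_relat (X : rep) a v w : (v, w) \in relat X a ->
  ((\1%VF : 'End(X (tail_of a))) v, (\1%VF : 'End(X (head_of a))) w) \in relat X a.
Proof. by rewrite !id_lfunE. Qed.

Definition idh (X : rep) : hom X X :=
  @Hom X X (fun i => \1%VF) (@idh_relat X).

Fact comph_relat (X Y Z : rep) (g : hom Y Z) (f : hom X Y) a v w :
  (v, w) \in relat X a ->
  ((g (tail_of a) \o f (tail_of a))%VF v, (g (head_of a) \o f (head_of a))%VF w)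
    \in relat Z a.
Proof. by move=> vw; rewrite !comp_lfunE; do 2!apply: hom_relat. Qed.

Definition comph (X Y Z : rep) (g : hom Y Z) (f : hom X Y) : hom X Z :=
  @Hom X Z (fun i => (g i \o f i)%VF) (@comph_relat X Y Z g f).

Fact zeroh_relat (X Y : rep) a v w : (v, w) \in relat X a ->
  ((0 : 'Hom(X (tail_of a), Y (tail_of a))) v, (0 : 'Hom(X (head_of a), Y (head_of a))) w)
    \in relat Y a.
Proof. by rewrite !zero_lfunE => _; apply: mem0v. Qed.

Definition zeroh (X Y : rep) : hom X Y :=
  @Hom X Y (fun i => 0) (@zeroh_relat X Y).

Fact addh_relat (X Y : rep) (f g : hom X Y) a v w : (v, w) \in relat X a ->
  ((f (tail_of a) + g (tail_of a)) v, (f (head_of a) + g (head_of a)) w) \in relat Y a.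
Proof.
move=> vw; rewrite !add_lfunE.
exact: (rpredD (hom_relat f vw) (hom_relat g vw)).
Qed.

Definition addh (X Y : rep) (f g : hom X Y) : hom X Y :=
  @Hom X Y (fun i => f i + g i) (@addh_relat X Y f g).

Definition is_iso (X Y : rep) (f : hom X Y) : Prop :=
  exists g : hom Y X,
    hom_eq (comph g f) (idh X) /\ hom_eq (comph f g) (idh Y).

Definition split_mono (X Y : rep) (f : hom X Y) : Prop :=
  exists g : hom Y X, hom_eq (comph g f) (idh X).

Definition split_epi (X Y : rep) (f : hom X Y) : Prop :=
  exists g : hom Y X, hom_eq (comph f g) (idh Y).

Definition zero_object (X : rep) : Prop := hom_eq (idh X) (zeroh X X).

Definition is_direct_sum (X Y Z : rep) : Prop :=
  exists (i1 : hom Y X) (i2 : hom Z X) (p1 : hom X Y) (p2 : hom X Z),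
    [/\ hom_eq (comph p1 i1) (idh Y),
        hom_eq (comph p2 i2) (idh Z),
        hom_eq (comph p1 i2) (zeroh Z Y),
        hom_eq (comph p2 i1) (zeroh Y Z)
      & hom_eq (addh (comph i1 p1) (comph i2 p2)) (idh X)].

Definition indecomposable (X : rep) : Prop :=
  ~ zero_object X /\
  forall Y Z : rep, is_direct_sum X Y Z -> zero_object Y \/ zero_object Z.

Definition exact_seq (X Y Z : rep) (f : hom X Y) (g : hom Y Z) : Prop :=
  (forall i : vertex E, short_exact (f i) (g i) fullv fullv fullv) /\
  (forall a : arrow E,
     short_exact (pair_lfun (f (tail_of a)) (f (head_of a)))
                 (pair_lfun (g (tail_of a)) (g (head_of a)))
                 (relat X a) (relat Y a) (relat Z a)).

Definition rel_projective (P : rep) : Prop :=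
  forall (X Y Z : rep) (f : hom X Y) (g : hom Y Z), exact_seq f g ->
  forall u : hom P Z, exists v : hom P Y, hom_eq (comph g v) u.

Definition rel_injective (I : rep) : Prop :=
  forall (X Y Z : rep) (f : hom X Y) (g : hom Y Z), exact_seq f g ->
  forall u : hom X I, exists v : hom Y I, hom_eq (comph v f) u.

Definition left_almost_split (X Y : rep) (f : hom X Y) : Prop :=
  ~ split_mono f /\
  forall (M : rep) (u : hom X M), ~ split_mono u ->
  exists v : hom Y M, hom_eq (comph v f) u.

Definition right_almost_split (Y Z : rep) (g : hom Y Z) : Prop :=
  ~ split_epi g /\
  forall (M : rep) (u : hom M Z), ~ split_epi u ->
  exists v : hom M Y, hom_eq (comph g v) u.

Definition left_minimal (X Y : rep) (f : hom X Y) : Prop :=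
  forall u : hom Y Y, hom_eq (comph u f) f -> is_iso u.

Definition right_minimal (Y Z : rep) (g : hom Y Z) : Prop :=
  forall u : hom Y Y, hom_eq (comph g u) g -> is_iso u.

Definition AR_sequence (X Y Z : rep) (f : hom X Y) (g : hom Y Z) : Prop :=
  [/\ exact_seq f g,
      left_minimal f /\ left_almost_split f
    & right_minimal g /\ right_almost_split g].

Definition has_AR_sequences : Prop :=
  (forall Z : rep, indecomposable Z -> ~ rel_projective Z ->
     exists (X Y : rep) (f : hom X Y) (g : hom Y Z), AR_sequence f g) /\
  (forall X : rep, indecomposable X -> ~ rel_injective X ->
     exists (Y Z : rep) (f : hom X Y) (g : hom Y Z), AR_sequence f g).

End Rep.

(* Main.v *)
From HB Require Import structures.
From mathcomp Require Import all_boot all_algebra.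
From mathcomp Require Import zify.
From Stdlib Require Import Classical ClassicalEpsilon.
Require Import Defs.
Set Implicit Arguments.
Unset Strict Implicit.
Unset Printing Implicit Defensive.
Import GRing.Theory VectorInternalTheory.
Local Open Scope ring_scope.

(** Why the theorem is true.

    Fix a representation [Z].  An extension of [Z] by [X] is determined by how
    each relation of [Z] is lifted, so extensions are given by cocycles: for
    every arrow [a] a linear map from pairs over [Z] to [X] at the tail of [a],
    the values at [a] and at [star a] being the two coordinates of the
    correction.  The extension splits when the cocycle is a coboundary modulo
    the relations of [X], and the classes of cocycles form [Ext(Z, X)].

    The linear forms on [Ext(Z, X)] are, naturally in [X], the families of
    linear maps from [X] to one fixed system of relations [extdual Z] that
    respect all relations; the form attached to such a family is a sum of
    traces ([pairing_split], [pairing_separates]).  This system would play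
    the role of the Auslander-Reiten translate of [Z], were its relations of the
    types that [phi] prescribes.  They need not be, and the point where the hypothesis on
    cycles enters is that every system of relations has a right approximation
    by a representation ([right_approximation]).  The kernel of the relation
    at an arrow outside [Omega] is removed by recording, in a new summand at
    the head of the arrow, the element at its tail; this can spoil only the
    arrows outside [Omega] that continue the arrow without backtracking, so it
    terminates because no oriented cycle avoids [Omega].  Afterwards one passes
    to the largest subsystem in which the relations at the arrows of [Omega]
    are defined everywhere.

    Let [I] be the approximation of [extdual Z].  If some [Ext(Z, X)] is
    nonzero, then for an indecomposable summand [I1] of [I] either some nonzero
    class in [Ext(Z, I1)] is killed by every form that comes from a map
    [I1 -> I] that is not a split monomorphism, or the complement of [I1] in
    [I] still induces all forms ([generates_almost_split]).  By induction on the
    dimension the first case occurs for some [I1], and that class is killed by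
    every map out of [I1] that is not a split monomorphism.  For [Z]
    indecomposable, Fitting's lemma then shows that the corresponding extension
    is an Auslander-Reiten sequence ([extension_AR]).

    Sequences with a given left end follow by vector space duality, which
    replaces [Omega] by its complement ([dual_AR]); this is why cycles with
    [phi] constantly 1 are excluded as well. *)

(** * Linear algebra *)

Section LinearAlgebra.
Variable K : fieldType.
Implicit Types V W : vectType K.

Lemma linear_lfunE V W (f : V -> W) : linear f -> linfun f =1 f.
Proof.
move=> f_lin.
pose g : {linear V -> W} := HB.pack f (GRing.isLinear.Build K V W *:%R f f_lin).
exact: (lfunE g).
Qed.

Lemma lfun_lin V W (f : 'Hom(V, W)) k u v : f (k *: u + v) = k *: f u + f v.
Proof. exact: linearP. Qed.

Lemma lfun0 V W (f : 'Hom(V, W)) : f 0 = 0.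
Proof. exact: linear0. Qed.

Lemma lfunB V W (f : 'Hom(V, W)) u v : f (u - v) = f u - f v.
Proof. exact: linearB. Qed.

Lemma lfunD V W (f : 'Hom(V, W)) u v : f (u + v) = f u + f v.
Proof. exact: linearD. Qed.

Lemma lfunZ V W (f : 'Hom(V, W)) k v : f (k *: v) = k *: f v.
Proof. exact: linearZ. Qed.

Lemma pair_lin V W k (v v' : V) (w w' : W) :
  (k *: v + v', k *: w + w') = k *: ((v, w) : (V * W)%type) + ((v', w') : (V * W)%type).
Proof. by []. Qed.

Definition lin_closed V (P : V -> Prop) : Prop :=
  P 0 /\ forall k u v, P u -> P v -> P (k *: u + v).

Lemma lin_closed_vspace V (P : V -> Prop) : lin_closed P ->
  exists U : {vspace V}, forall v, v \in U <-> P v.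
Proof.
case=> P0 PD.
suff grow n (U : {vspace V}) : (forall v, v \in U -> P v) ->
    (\dim {:V} - \dim U <= n)%N -> exists U' : {vspace V}, forall v, v \in U' <-> P v.
  apply: (grow (\dim {:V}) 0%VS); last by rewrite leq_subr.
  by move=> v; rewrite memv0 => /eqP->.
elim: n U => [|n IHn] U UP dU.
  exists U => v; split=> [/UP //|_].
  have: (fullv <= U)%VS by rewrite -(geq_leqif (dimv_leqif_sup (subvf U))) -subn_eq0 -leqn0.
  by move/subvP; apply; apply: memvf.
case: (classic (forall v, P v -> v \in U)) => [PU|].
  by exists U => v; split; [apply: UP | apply: PU].
move=> nPU; have [v nPv] := not_all_ex_not _ _ nPU.
have [Pv /negP vU] := imply_to_and _ _ nPv.
apply: (IHn (U + <[v]>)%VS) => [w /memv_addP[u uU [_ /vlineP[k ->] ->]]|].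
  by rewrite addrC; apply: PD => //; apply: UP.
have ltUv : (\dim U < \dim (U + <[v]>))%N.
  rewrite ltnNge; apply: contra vU => le_d.
  suff /eqP-> : U == (U + <[v]>)%VS by apply: (subvP (addvSr _ _)); apply: memv_line.
  by rewrite eqEdim addvSl le_d.
have := dimvS (subvf (U + <[v]>)%VS).
by move: dU ltUv; case: (\dim fullv) => [//|d]; rewrite !leq_subLR; lia.
Qed.

(** Comprehension: subspaces are given by predicates, and choice supplies the
    subspace, so that no generating family has to be exhibited. *)
Definition vset V (P : V -> Prop) : {vspace V} :=
  epsilon (inhabits 0%VS) (fun U => forall v, v \in U <-> P v).

Lemma mem_vset V (P : V -> Prop) : lin_closed P -> forall v, v \in vset P <-> P v.
Proof. by move=> /lin_closed_vspace ex; apply: (epsilon_spec _ _ ex). Qed.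

(** A linear relation contains the graph of a linear map on its domain. *)
Lemma linear_choice V W (R : {vspace (V * W)%type}) :
  exists f : 'Hom(V, W), forall v w, (v, w) \in R -> (v, f v) \in R.
Proof.
pose p : 'Hom(subvs_of R, V) := (fst_lfun V W \o linfun vsval)%VF.
pose q : 'Hom(subvs_of R, W) := (snd_lfun V W \o linfun vsval)%VF.
exists (q \o p^-1)%VF => v w vwR; rewrite comp_lfunE.
have pE u : p u = (vsval u).1 by rewrite comp_lfunE fst_lfunE lfunE.
have qE u : q u = (vsval u).2 by rewrite comp_lfunE snd_lfunE lfunE.
have v_im : v \in limg p.
  by apply/memv_imgP; exists (Subvs vwR); rewrite ?memvf // pE.
rewrite -[X in (X, _)](limg_lfunVK v_im) pE qE -surjective_pairing.
exact: subvsP.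
Qed.

Lemma linear_section V W (P : V -> W -> Prop) :
  lin_closed (fun p : (V * W)%type => P p.1 p.2) ->
  exists f : 'Hom(V, W), forall v w, P v w -> P v (f v).
Proof.
move=> Plin; have [R RP] := lin_closed_vspace Plin.
have [f fR] := linear_choice R.
by exists f => v w /(RP (v, w)) /fR /RP.
Qed.

(** The form is the functional relation [v' |-> k] given by
    [v' - k *: v \in U]; it is single-valued because [v] is not in [U]. *)
Lemma separation V (U : {vspace V}) v : v \notin U ->
  exists l : 'Hom(V, K^o), (forall u, u \in U -> l u = 0) /\ l v = 1.
Proof.
move=> vU; pose P (x : V) (k : K^o) := x - k *: v \in U.
have Plin : lin_closed (fun p : (V * K^o)%type => P p.1 p.2).
  split=> [|k [x a] [y b] /= xU yU]; rewrite /P /= ?scale0r ?subrr ?mem0v //.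
  have -> : k *: x + y - (k *: a + b) *: v = k *: (x - a *: v) + (y - b *: v).
    by rewrite scalerDl -scalerA scalerBr opprD addrACA.
  by rewrite rpredD // rpredZ.
have [l lP] := @linear_section V K^o P Plin.
have luniq x (a : K) : P x a -> l x = a.
  move=> Pxa; have Pxl := lP _ _ Pxa; apply/eqP; rewrite -subr_eq0; apply/negPn.
  apply: contra vU => nz; have : (l x - a) *: v \in U.
    have -> : (l x - a) *: v = (x - a *: v) - (x - l x *: v).
      by rewrite opprB [RHS]addrC addrA subrK scalerBl.
    by apply: rpredB.
  by move=> avU; rewrite -[v]scale1r -(mulVf nz) -scalerA memvZ.
exists l; split=> [u uU|]; apply: luniq; rewrite /P ?scale0r ?subr0 //.
by rewrite scale1r subrr mem0v.
Qed.

Definition ltrace V (f : 'End(V)) : K := \tr (f2mx f).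

Lemma lfun_mxE V W (f : 'Hom(V, W)) v : f v = r2v (v2r v *m f2mx f).
Proof. by rewrite unlock. Qed.

Lemma f2mx_eq V W (f : 'Hom(V, W)) A : (forall v, f v = r2v (v2r v *m A)) -> f2mx f = A.
Proof. by move=> fA; have -> : f = vector.Hom A by apply/lfunP => v; rewrite fA lfun_mxE. Qed.

Lemma f2mx_comp V W (U : vectType K) (f : 'Hom(V, W)) (g : 'Hom(W, U)) :
  f2mx (g \o f)%VF = f2mx f *m f2mx g.
Proof. by apply: f2mx_eq => v; rewrite comp_lfunE !lfun_mxE r2vK mulmxA. Qed.

Fact f2mx_linear V W : linear (@f2mx K V W).
Proof.
move=> k f g; apply: f2mx_eq => v; rewrite add_lfunE scale_lfunE !lfun_mxE.
by rewrite mulmxDr -scalemxAr linearD linearZ.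
Qed.

HB.instance Definition _ V W :=
  GRing.isLinear.Build K 'Hom(V, W) 'M[K]_(dim V, dim W) _ (@f2mx K V W) (@f2mx_linear V W).

Fact ltrace_linear V : linear (@ltrace V : 'End(V) -> K^o).
Proof. by move=> k f g; rewrite /ltrace linearP /= mxtraceD mxtraceZ. Qed.

HB.instance Definition _ V :=
  GRing.isLinear.Build K 'End(V) K^o _ (@ltrace V) (@ltrace_linear V).

Lemma ltraceD V (f g : 'End(V)) : ltrace (f + g) = ltrace f + ltrace g.
Proof. exact: linearD. Qed.

Lemma ltrace0 V : ltrace (0 : 'End(V)) = 0.
Proof. exact: linear0. Qed.

Lemma ltraceC V W (f : 'Hom(V, W)) (g : 'Hom(W, V)) :
  ltrace (g \o f)%VF = ltrace (f \o g)%VF.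
Proof. by rewrite /ltrace !f2mx_comp mxtrace_mulC. Qed.

Lemma ltrace_scalar (f : 'End(K^o)) : ltrace f = f 1.
Proof.
have -> : f = f 1 *: \1%VF.
  apply/lfunP => x; rewrite scale_lfunE id_lfunE -[X in f X]mulr1 -[x * 1]/(x *: (1 : K^o)).
  by rewrite linearZ; apply: mulrC.
rewrite scale_lfunE id_lfunE linearZ /= /ltrace.
have -> : f2mx (\1%VF : 'End(K^o)) = 1%:M by apply: f2mx_eq => v; rewrite id_lfunE mulmx1 v2rK.
by rewrite mxtrace1 /=.
Qed.

Definition outer V W (l : 'Hom(V, K^o)) (w : W) : 'Hom(V, W) := linfun (fun v => l v *: w).

Lemma outerE V W (l : 'Hom(V, K^o)) (w : W) v : outer l w v = l v *: w.
Proof. by rewrite linear_lfunE // => k x y; rewrite linearP scalerDl scalerA. Qed.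

Lemma ltrace_outer V W (F : 'Hom(W, V)) (l : 'Hom(V, K^o)) w :
  ltrace (F \o outer l w)%VF = l (F w).
Proof.
pose e : 'Hom(K^o, V) := linfun (fun k : K^o => k *: F w).
have eE k : e k = k *: F w.
  by rewrite linear_lfunE // => a x y; rewrite scalerDl scalerA.
have -> : (F \o outer l w)%VF = (e \o l)%VF.
  by apply/lfunP => v; rewrite !comp_lfunE outerE linearZ eE.
by rewrite ltraceC ltrace_scalar comp_lfunE eE scale1r.
Qed.

(** The coefficients of [F] are the values of [L] on the matrix units. *)
Lemma ltrace_dual V W (L : 'Hom('Hom(V, W), K^o)) :
  exists F : 'Hom(W, V), forall g, L g = ltrace (F \o g)%VF.
Proof.
pose A : 'M[K]_(dim W, dim V) := \matrix_(j, i) L (vector.Hom (delta_mx i j)).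
exists (vector.Hom A) => g; rewrite /ltrace f2mx_comp /=.
have {1}-> : g = \sum_i \sum_j f2mx g i j *: vector.Hom (delta_mx i j).
  apply: val_inj => /=; rewrite [LHS]matrix_sum_delta linear_sum; apply: eq_bigr => i _.
  by rewrite linear_sum; apply: eq_bigr => j _; rewrite linearZ.
rewrite linear_sum; apply: eq_bigr => i _; rewrite linear_sum mxE.
by apply: eq_bigr => j _; rewrite linearZ mxE.
Qed.

Lemma bidual V (L : 'Hom('Hom(V, K^o), K^o)) :
  exists v : V, forall l, L l = l v.
Proof.
have [F LF] := ltrace_dual L; exists (F 1) => l.
by rewrite LF ltraceC ltrace_scalar comp_lfunE.
Qed.

(** In finite dimension a form that vanishes on the common zeros of a space of
    forms belongs to this space. *)
Lemma bidual_span V (G : {vspace 'Hom(V, K^o)}) (l : 'Hom(V, K^o)) :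
  (forall v, (forall g, g \in G -> g v = 0) -> l v = 0) -> l \in G.
Proof.
move=> lG; apply/negPn/negP => /separation[L [LG Ll]].
have [v Lv] := bidual L; move: Ll; rewrite Lv lG => [/esym/eqP|g gG].
  by rewrite oner_eq0.
by rewrite -Lv LG.
Qed.

(** The pairs [(f v + c, l v)] with [c] in [C] form a linear relation, which the
    hypothesis makes single-valued; it extends to a form on [W]. *)
Lemma functional_extension V W (f : 'Hom(V, W)) (C : {vspace W}) (l : 'Hom(V, K^o)) :
    (forall v, f v \in C -> l v = 0) ->
  exists m : 'Hom(W, K^o), (forall v, m (f v) = l v) /\ forall w, w \in C -> m w = 0.
Proof.
move=> lC; pose P (w : W) (k : K^o) := exists v, w - f v \in C /\ k = l v.
have Plin : lin_closed (fun p : (W * K^o)%type => P p.1 p.2).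
  split=> [|k [x a] [y b] /= [u [uC ->]] [v [vC ->]]].
    by exists 0; rewrite !linear0 addr0 mem0v.
  exists (k *: u + v); rewrite (linearP f) (linearP l); split=> //=.
  by rewrite opprD addrACA -scalerBr rpredD // rpredZ.
have [m mP] := @linear_section W K^o P Plin.
have mC v w : w - f v \in C -> m w = l v.
  move=> vC; have [v' [v'C ->]] : P w (m w) by apply: (mP w (l v)); exists v.
  apply/eqP; rewrite -subr_eq0; apply/eqP.
  have <- : l (v' - v) = l v' - l v by rewrite linearB.
  apply: lC; rewrite linearB.
  have -> : f v' - f v = (w - f v) - (w - f v') by rewrite opprB [RHS]addrC addrA subrK.
  exact: rpredB.
exists m; split=> [v|w wC]; first by apply: mC; rewrite subrr mem0v.
have wfC : w - f 0 \in C by rewrite (linear0 f) subr0.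
by rewrite (mC _ _ wfC) linear0.
Qed.

Lemma iter_limg_stable V (f : 'End(V)) (A : {vspace V}) : (f @: A <= A)%VS ->
  exists N, forall n, (N <= n)%N -> (iter n (lfun_img f) A = iter N (lfun_img f) A)%VS.
Proof.
move=> fA; suff stab d (B : {vspace V}) : (f @: B <= B)%VS -> (\dim B <= d)%N ->
    exists N, forall n, (N <= n)%N -> (iter n (lfun_img f) B = iter N (lfun_img f) B)%VS.
  exact: (stab (\dim A)).
elim: d B => [|d IHd] B fB dB.
  exists 0%N => n _; suff -> : B = 0%VS by elim: n => //= n ->; rewrite limg0.
  by apply/eqP; rewrite -dimv_eq0 -leqn0.
case: (leqP (\dim B) (\dim (f @: B))) => [dfB|dfB].
  have e : (f @: B)%VS = B by apply/eqP; rewrite eqEdim fB.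
  by exists 0%N => n _; elim: n => //= n ->.
have [|| N HN] := IHd (f @: B)%VS; [exact: limgS | by rewrite -ltnS (leq_trans dfB) |].
by exists N.+1 => -[|n] // lt_Nn; rewrite iterSr HN // -iterSr.
Qed.

End LinearAlgebra.

(** * Representations and their homomorphisms, pointwise *)

Section Representations.
Variables (K : fieldType) (E : equippedGraph).

Lemma mem_cast_linrel (I : Type) (V : I -> vectType K)
    (Q : forall i j, V i -> V j -> Prop) i i' j j' (ei : i = i') (ej : j = j')
    (R : linrel (V i) (V j)) :
  (forall v w, (v, w) \in R <-> Q i j v w) ->
  forall v w, (v, w) \in cast_linrel ei ej R <-> Q i' j' v w.
Proof. by case: i' / ei; case: j' / ej. Qed.

(** The relation at [a] between the spaces at arbitrary vertices [i] and [j],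
    empty unless [i] and [j] are the ends of [a].  Stated this way, the
    relations at [a] and [star a] are compared with no transport along the
    equality of the head of [star a] and the tail of [a]. *)
Definition relx (X : rep K E) (a : arrow E) i j (v : X i) (w : X j) : Prop :=
  exists (e1 : tail_of a = i) (e2 : head_of a = j), (v, w) \in cast_linrel e1 e2 (relat X a).

Section OneRep.
Variable X : rep K E.
Implicit Types (a : arrow E) (i j : vertex E).

Lemma relxE a (v : X (tail_of a)) (w : X (head_of a)) :
  relx a v w <-> (v, w) \in relat X a.
Proof.
split=> [[e1 [e2]]|vw]; last by exists erefl, erefl.
by rewrite (eq_irrelevance e1 erefl) (eq_irrelevance e2 erefl).
Qed.

Lemma relx_tail a i j (v : X i) (w : X j) : relx a v w -> tail_of a = i.
Proof. by case. Qed.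

Lemma relx_head a i j (v : X i) (w : X j) : relx a v w -> head_of a = j.
Proof. by case=> ? []. Qed.

Lemma relx_swap a i j (v : X i) (w : X j) : relx a v w -> relx (star a) w v.
Proof.
case=> e1 [e2]; case: i / e1 v; case: j / e2 w => w v /= vw.
exists (tail_of_star a), (head_of_star a).
by rewrite relat_star mem_rel_inv.
Qed.

Lemma relx_star a i j (v : X i) (w : X j) : relx (star a) w v <-> relx a v w.
Proof. by split=> /relx_swap; rewrite ?starK. Qed.

Lemma relx_closed a i j : tail_of a = i -> head_of a = j ->
  lin_closed (fun p : (X i * X j)%type => relx a p.1 p.2).
Proof.
move=> <- <-; split=> [|k u v /relxE uR /relxE vR]; apply/relxE.
  exact: mem0v.
by rewrite /= -[(_, _)]/(k *: (u.1, u.2) + (v.1, v.2)) rpredD // rpredZ.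
Qed.

Lemma relx0 a i j : tail_of a = i -> head_of a = j -> relx a (0 : X i) (0 : X j).
Proof. by move=> ei ej; case: (relx_closed ei ej). Qed.

Lemma relxP a i j k (v v' : X i) (w w' : X j) : relx a v w -> relx a v' w' ->
  relx a (k *: v + v') (k *: w + w').
Proof.
move=> vw vw'; case: (relx_closed (relx_tail vw) (relx_head vw)) => _ R.
exact: (R k (v, w) (v', w')).
Qed.

Lemma relxZ a i j k (v : X i) (w : X j) : relx a v w -> relx a (k *: v) (k *: w).
Proof.
move=> vw; have := relxP k vw (relx0 (relx_tail vw) (relx_head vw)).
by rewrite !addr0.
Qed.

Lemma relxB a i j (v v' : X i) (w w' : X j) : relx a v w -> relx a v' w' ->
  relx a (v - v') (w - w').
Proof. by move=> vw /(relxP (-1)) /(_ vw); rewrite !scaleN1r ![- _ + _]addrC. Qed.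

Lemma relx_def a i j (v : X i) : phi a -> tail_of a = i -> head_of a = j ->
  exists w : X j, relx a v w.
Proof.
move=> pa ei ej; case: i / ei v; case: j / ej => v.
have := relat_equipped X a; rewrite /equipped pa => /andP[/eqP def _].
have /mem_rel_defP[w vw] : v \in rel_def (relat X a) by rewrite def memvf.
by exists w; apply/relxE.
Qed.

Lemma relx_ker a i j (v : X i) : ~~ phi a -> relx a v (0 : X j) -> v = 0.
Proof.
move=> pa [e1 [e2]]; case: i / e1 v; case: j / e2 => v /= v0.
have := relat_equipped X a; rewrite /equipped (negPf pa) => /andP[/eqP ker _].
by apply/eqP; rewrite -memv0 -ker mem_rel_ker.
Qed.

End OneRep.

(** What is needed to build a representation from relations at arbitrary
    vertices; the conditions at the head of an arrow [a] are those at the tail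
    of [star a]. *)
Record relation_family (V : vertex E -> vectType K)
    (Q : arrow E -> forall i j, V i -> V j -> Prop) : Prop := RelationFamily {
  family_closed : forall a,
    lin_closed (fun p : (V (tail_of a) * V (head_of a))%type => Q a _ _ p.1 p.2);
  family_swap : forall a i j (v : V i) (w : V j),
    tail_of a = i -> head_of a = j -> Q a i j v w -> Q (star a) j i w v;
  family_def : forall a i j (v : V i), tail_of a = i -> head_of a = j -> phi a ->
    exists w : V j, Q a i j v w;
  family_ker : forall a i j (v : V i), tail_of a = i -> head_of a = j -> ~~ phi a ->
    Q a i j v (0 : V j) -> v = 0
}.

Section MakeRep.
Variables (V : vertex E -> vectType K) (Q : arrow E -> forall i j, V i -> V j -> Prop).
Hypothesis Qfam : relation_family Q.

Definition mk_relat a : linrel (V (tail_of a)) (V (head_of a)) :=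
  vset (fun p => Q a p.1 p.2).

Lemma mem_mk_relat a v w : (v, w) \in mk_relat a <-> Q a v w.
Proof. exact: (mem_vset (family_closed Qfam a) (v, w)). Qed.

Lemma family_swapV a i j (v : V i) (w : V j) : tail_of a = i -> head_of a = j ->
  Q (star a) w v -> Q a v w.
Proof.
move=> ei ej /(family_swap Qfam); rewrite starK; apply.
  by rewrite tail_of_star.
by rewrite head_of_star.
Qed.

Fact mk_relat_equipped a : equipped (mk_relat a) (phi a) (phi (star a)).
Proof.
apply/andP; split; case: ifPn => pa.
- apply/eqP/vspaceP => v; rewrite memvf; apply/mem_rel_defP.
  have [//|//|w vw] := family_def Qfam (a := a) (j := head_of a) v _ _ pa.
  by exists w; apply/mem_mk_relat.
- apply/eqP/vspaceP => v; rewrite memv0 mem_rel_ker.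
  apply/idP/eqP => [/mem_mk_relat|->]; last exact: mem0v.
  exact: family_ker.
- apply/eqP/vspaceP => w; rewrite memvf; apply/mem_rel_imP.
  have [||v vw] := family_def Qfam (a := star a) (j := tail_of a) w _ _ pa.
  + exact: tail_of_star.
  + exact: head_of_star.
  by exists v; apply/mem_mk_relat; apply: family_swapV.
apply/eqP/vspaceP => w; rewrite memv0 mem_rel_ind.
apply/idP/eqP => [/mem_mk_relat/family_swap|->]; last exact: mem0v.
move=> /(_ Qfam erefl erefl); apply: family_ker => //.
  exact: tail_of_star.
exact: head_of_star.
Qed.

Fact mk_relat_star a :
  cast_linrel (tail_of_star a) (head_of_star a) (mk_relat (star a)) = rel_inv (mk_relat a).
Proof.
apply/vspaceP => -[w v]; rewrite mem_rel_inv; apply/idP/idP.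
  move/(mem_cast_linrel _ _ (@mem_mk_relat (star a))) => wv.
  by apply/mem_mk_relat; apply: family_swapV.
move/mem_mk_relat => vw.
by apply/(mem_cast_linrel _ _ (@mem_mk_relat (star a))); apply: family_swap.
Qed.

Definition mk_rep : rep K E := Rep mk_relat_equipped mk_relat_star.

Lemma relx_mk a i j (v : V i) (w : V j) :
  relx (X := mk_rep) a v w <-> [/\ tail_of a = i, head_of a = j & Q a v w].
Proof.
split=> [[e1 [e2]]|[e1 e2]].
  by move/(mem_cast_linrel _ _ (@mem_mk_relat a)).
by move=> vw; exists e1, e2; apply/(mem_cast_linrel _ _ (@mem_mk_relat a)).
Qed.

End MakeRep.

Section Homs.
Implicit Types X Y Z : rep K E.

Lemma hom_relx X Y (f : hom X Y) a i j (v : X i) (w : X j) :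
  relx a v w -> relx a (f i v) (f j w).
Proof.
case=> e1 [e2]; case: i / e1 v; case: j / e2 w => w v /= vw.
by apply/relxE; apply: hom_relat.
Qed.

Lemma mk_hom_relat X Y (f : forall i, 'Hom(X i, Y i)) :
    (forall a i j (v : X i) (w : X j), relx a v w -> relx a (f i v) (f j w)) ->
  forall a v w, (v, w) \in relat X a ->
    (f (tail_of a) v, f (head_of a) w) \in relat Y a.
Proof. by move=> fR a v w /relxE vw; apply/relxE; apply: fR. Qed.

Definition mk_hom X Y (f : forall i, 'Hom(X i, Y i))
    (fR : forall a i j (v : X i) (w : X j), relx a v w -> relx a (f i v) (f j w)) :
  hom X Y := Hom (mk_hom_relat fR).

Lemma comphE X Y Z (g : hom Y Z) (f : hom X Y) i x : comph g f i x = g i (f i x).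
Proof. by rewrite comp_lfunE. Qed.

Lemma idhE X i x : idh X i x = x. Proof. exact: id_lfunE. Qed.

Lemma hom_eqE X Y (f g : hom X Y) : hom_eq f g <-> forall i x, f i x = g i x.
Proof. by split=> fg i; [move=> x; rewrite fg | apply/lfunP/fg]. Qed.

Fact lin_hom_relx X Y k (f g : hom X Y) a i j (v : X i) (w : X j) :
  relx a v w -> relx a ((k *: f i + g i) v) ((k *: f j + g j) w).
Proof. by move=> vw; rewrite !add_lfunE !scale_lfunE; apply: relxP; apply: hom_relx. Qed.

Definition lin_hom X Y k (f g : hom X Y) : hom X Y := mk_hom (lin_hom_relx k f g).

Lemma lin_homE X Y k (f g : hom X Y) i x : lin_hom k f g i x = k *: f i x + g i x.
Proof. by rewrite add_lfunE scale_lfunE. Qed.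

Fixpoint hom_iter X (u : hom X X) n : hom X X :=
  if n is n'.+1 then comph u (hom_iter u n') else idh X.

Lemma hom_iterE X (u : hom X X) n i x : hom_iter u n i x = iter n (u i) x.
Proof. by elim: n => [|n IHn] /=; rewrite ?idhE // comp_lfunE IHn. Qed.

Lemma zero_objectE X : zero_object X <-> forall i (x : X i), x = 0.
Proof.
split=> [/hom_eqE X0 i x|X0 i]; last by apply/lfunP => x; rewrite [LHS]X0 [RHS]X0.
by have := X0 i x; rewrite idhE zero_lfunE.
Qed.

Lemma split_monoE X Y (f : hom X Y) :
  split_mono f <-> exists g : hom Y X, forall i x, g i (f i x) = x.
Proof.
split=> -[g gf]; exists g; last by apply/hom_eqE => i x; rewrite comphE idhE.
by move=> i x; have/hom_eqE := gf; move/(_ i x); rewrite comphE idhE.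
Qed.

Lemma split_epiE X Y (f : hom X Y) :
  split_epi f <-> exists g : hom Y X, forall i x, f i (g i x) = x.
Proof.
split=> -[g gf]; exists g; last by apply/hom_eqE => i x; rewrite comphE idhE.
by move=> i x; have/hom_eqE := gf; move/(_ i x); rewrite comphE idhE.
Qed.

Lemma is_isoE X Y (f : hom X Y) : is_iso f <->
  exists g : hom Y X, (forall i x, g i (f i x) = x) /\ forall i x, f i (g i x) = x.
Proof.
split=> -[g [gf fg]]; exists g.
  split=> i x.
    by have/hom_eqE := gf; move/(_ i x); rewrite comphE idhE.
  by have/hom_eqE := fg; move/(_ i x); rewrite comphE idhE.
by split; apply/hom_eqE => i x; rewrite comphE idhE.
Qed.

(** An injective endomorphism maps each relation injectively to itself, hence
    onto itself by dimension, so the vertexwise inverses respect relations. *)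
Lemma injective_endo_iso X (u : hom X X) : (forall i x, u i x = 0 -> x = 0) -> is_iso u.
Proof.
move=> u0; have ker0 i : lker (u i) == 0%VS.
  by rewrite -subv0; apply/subvP => x; rewrite memv_ker memv0 => /eqP/u0->.
have uV i : cancel (u i)^-1%VF (u i) by apply: lker0_lfunVK.
have uK i : cancel (u i) (u i)^-1%VF by apply: lker0_lfunK.
pose g i : 'Hom(X i, X i) := (u i)^-1%VF.
have gR a i j (v : X i) (w : X j) : relx a v w -> relx a (g i v) (g j w).
  case=> e1 [e2]; case: i / e1 v; case: j / e2 w => w v /= vw; apply/relxE.
  pose p := pair_lfun (u (tail_of a)) (u (head_of a)).
  have pX : (p @: relat X a <= relat X a)%VS.
    apply/subvP => _ /memv_imgP[[x y] xy ->]; rewrite pair_lfunE /=.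
    exact: hom_relat.
  have p0 : (relat X a :&: lker p = 0)%VS.
    apply/eqP; rewrite -subv0; apply/subvP => -[x y]; rewrite memv_cap memv_ker memv0.
    rewrite pair_lfunE => /andP[_ /eqP pxy].
    have x0 : x = 0 := u0 _ x (congr1 fst pxy).
    have y0 : y = 0 := u0 _ y (congr1 snd pxy).
    by rewrite x0 y0; apply: eqxx.
  have /eqP pE : (p @: relat X a)%VS == relat X a by rewrite eqEdim pX (limg_dim_eq p0) /=.
  move: vw; rewrite -{1}pE => /memv_imgP[[x y] xy].
  by rewrite pair_lfunE => -[-> ->]; rewrite /g !uK.
by apply/is_isoE; exists (mk_hom gR); split=> i x; rewrite /= ?uK ?uV.
Qed.

End Homs.
End Representations.

(** * Subrepresentations, direct summands and Fitting's lemma *)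

Section Summands.
Variables (K : fieldType) (E : equippedGraph).
Implicit Types X Y Z : rep K E.

Section Subrep.
Variables (X : rep K E) (S : forall i, {vspace X i}).

(** Restricting relations to subspaces preserves trivial kernels; the only
    condition for a subrepresentation is that relations remain defined
    everywhere where [phi] is 1. *)
Definition def_stable : Prop := forall a i j (v : X i),
  tail_of a = i -> head_of a = j -> phi a -> v \in S i ->
  exists w : X j, w \in S j /\ relx a v w.

Hypothesis Sdef : def_stable.

Lemma subrep_family : relation_family (V := fun i => subvs_of (S i))
  (fun a i j v w => relx a (vsval v) (vsval w)).
Proof.
split=> [a|a i j v w _ _|a i j v ei ej pa|a i j v _ _ pa].
- have [R0 RP] := relx_closed X (erefl (tail_of a)) (erefl (head_of a)).
  split=> [|k u v]; [exact: R0 | exact: (RP k (vsval u.1, vsval u.2) (vsval v.1, vsval v.2))].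
- exact: relx_swap.
- have [w [wS vw]] := Sdef ei ej pa (subvsP v).
  by exists (Subvs wS).
by move=> /(relx_ker pa) v0; apply: subvs_inj.
Qed.

Definition subrep : rep K E := mk_rep subrep_family.

Lemma relx_sub a i j (v : subrep i) (w : subrep j) :
  relx a v w <-> relx a (vsval v) (vsval w).
Proof.
rewrite relx_mk; split=> [[]//|vw].
by split=> //; [exact: relx_tail vw | exact: relx_head vw].
Qed.

Fact subrep_incl_relx a i j (v : subrep i) (w : subrep j) : relx a v w ->
  relx a (linfun (@vsval K _ (S i)) v) (linfun (@vsval K _ (S j)) w).
Proof. by move=> /relx_sub vw; rewrite !lfunE. Qed.

Definition subrep_incl : hom subrep X :=
  mk_hom (X := subrep) (f := fun i => linfun (@vsval K _ (S i))) subrep_incl_relx.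

Lemma subrep_inclE i (v : subrep i) : subrep_incl i v = vsval v.
Proof. exact: lfunE. Qed.

Lemma subrep_lift Y (f : hom Y X) : (forall i x, f i x \in S i) ->
  exists g : hom Y subrep, forall i x, subrep_incl i (g i x) = f i x.
Proof.
move=> fS; pose g i : 'Hom(Y i, subrep i) := (linfun (@vsproj K _ (S i)) \o f i)%VF.
have gE i x : vsval (g i x) = f i x by rewrite comp_lfunE lfunE /= vsprojK ?fS.
have gR a i j (v : Y i) (w : Y j) : relx a v w -> relx a (g i v) (g j w).
  by move=> vw; apply/relx_sub; rewrite !gE; apply: hom_relx.
by exists (mk_hom gR) => i x; rewrite subrep_inclE -gE.
Qed.

End Subrep.

Definition direct_sum X Y Z (i1 : hom Y X) (i2 : hom Z X) (p1 : hom X Y) (p2 : hom X Z) :=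
  [/\ forall i x, p1 i (i1 i x) = x, forall i x, p2 i (i2 i x) = x,
      forall i x, p1 i (i2 i x) = 0, forall i x, p2 i (i1 i x) = 0
    & forall i x, i1 i (p1 i x) + i2 i (p2 i x) = x].

Lemma is_direct_sumE X Y Z :
  is_direct_sum X Y Z <-> exists i1 i2 p1 p2, direct_sum (X := X) (Y := Y) (Z := Z) i1 i2 p1 p2.
Proof.
split=> -[i1 [i2 [p1 [p2 [h11 h22 h12 h21 h]]]]]; exists i1, i2, p1, p2; last first.
  split; apply/hom_eqE => i x; rewrite ?comphE ?idhE ?zero_lfunE //.
  by rewrite add_lfunE !comp_lfunE; apply: h.
split=> i x.
- by move/hom_eqE/(_ i x): h11; rewrite comphE idhE.
- by move/hom_eqE/(_ i x): h22; rewrite comphE idhE.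
- by move/hom_eqE/(_ i x): h12; rewrite comphE zero_lfunE.
- by move/hom_eqE/(_ i x): h21; rewrite comphE zero_lfunE.
by move/hom_eqE/(_ i x): h; rewrite add_lfunE !comp_lfunE idhE.
Qed.

(** The complement is the kernel of [p1]: a partner [w] of [v] in this kernel is
    corrected to [w - i1 (p1 w)]. *)
Lemma retract_direct_sum X Y (i1 : hom Y X) (p1 : hom X Y) :
    (forall i x, p1 i (i1 i x) = x) ->
  exists (Z : rep K E) (i2 : hom Z X) (p2 : hom X Z), direct_sum i1 i2 p1 p2.
Proof.
move=> pi1; pose S i := lker (p1 i).
have Sdef : def_stable S.
  move=> a i j v ei ej pa; rewrite memv_ker => /eqP pv.
  have [w vw] := relx_def v pa ei ej; exists (w - i1 j (p1 j w)).
  split; first by rewrite memv_ker lfunB /= pi1 subrr.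
  have := relxB vw (hom_relx i1 (hom_relx p1 vw)).
  by rewrite pv lfun0 subr0.
pose e := lin_hom (-1) (comph i1 p1) (idh X).
have eE i x : e i x = x - i1 i (p1 i x).
  by rewrite lin_homE scaleN1r idhE comphE addrC.
have eS i x : e i x \in S i by rewrite memv_ker eE lfunB /= pi1 subrr.
have [p2 p2E] := subrep_lift Sdef eS.
have inj i (z : subrep Sdef i) : subrep_incl Sdef i z = 0 -> z = 0.
  by rewrite subrep_inclE => z0; apply: subvs_inj.
have pi2 i z : p1 i (subrep_incl Sdef i z) = 0.
  by apply/eqP; rewrite -memv_ker subrep_inclE; apply: subvsP.
exists (subrep Sdef), (subrep_incl Sdef), p2; split=> // i x.
- apply/eqP; rewrite -subr_eq0; apply/eqP/inj.
  by rewrite lfunB /= p2E eE pi2 lfun0 subr0 subrr.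
- by apply: inj; rewrite p2E eE pi1 subrr.
by rewrite p2E eE addrC subrK.
Qed.

Lemma idempotent_retract X (e : hom X X) : (forall i x, e i (e i x) = e i x) ->
  exists Y (i1 : hom Y X) (p1 : hom X Y),
    (forall i x, p1 i (i1 i x) = x) /\ forall i x, i1 i (p1 i x) = e i x.
Proof.
move=> ee; pose S i := limg (e i).
have Se i x : x \in S i -> e i x = x by move=> /memv_imgP[y _ ->].
have Sdef : def_stable S.
  move=> a i j v ei ej pa vS; have [w vw] := relx_def v pa ei ej.
  exists (e j w); split; first by rewrite memv_img ?memvf.
  by rewrite -(Se _ _ vS); apply: hom_relx.
have eS i x : e i x \in S i by rewrite memv_img ?memvf.
have [p1 p1E] := subrep_lift Sdef eS.
exists (subrep Sdef), (subrep_incl Sdef), p1; split=> // i x.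
apply: subvs_inj; rewrite -!subrep_inclE p1E Se // subrep_inclE.
exact: subvsP.
Qed.

Lemma indecomposable_idempotent X (e : hom X X) : indecomposable X ->
    (forall i x, e i (e i x) = e i x) ->
  (forall i x, e i x = 0) \/ (forall i x, e i x = x).
Proof.
move=> [_ Xindec] /idempotent_retract[Y [i1 [p1 [pi1 eE]]]].
have [Z [i2 [p2 sum]]] := retract_direct_sum pi1.
have /Xindec[] : is_direct_sum X Y Z by apply/is_direct_sumE; exists i1, i2, p1, p2.
  by move/zero_objectE => Y0; left=> i x; rewrite -eE (Y0 i (p1 i x)) lfun0.
move/zero_objectE => Z0; right=> i x; case: sum => _ _ _ _ /(_ i x) <-.
by rewrite -eE (Z0 i (p2 i x)) lfun0 addr0 pi1.
Qed.

Definition rdim X : nat := (\sum_i dim (X i))%N.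

Lemma injective_dim (V W : vectType K) (f : 'Hom(V, W)) :
  (forall x, f x = 0 -> x = 0) -> (dim V = \dim (limg f))%N.
Proof.
move=> f0; rewrite limg_dim_eq ?dimvf //.
apply/eqP; rewrite -subv0; apply/subvP => x.
by rewrite memv_cap memv_ker memv0 => /andP[_ /eqP/f0->].
Qed.

(** Splitting off a nonzero summand is a step of an induction on [rdim]. *)
Lemma direct_sum_rdim X Y Z i1 i2 p1 p2 :
  direct_sum (X := X) (Y := Y) (Z := Z) i1 i2 p1 p2 -> ~ zero_object Y -> (rdim Z < rdim X)%N.
Proof.
move=> [h11 h22 h12 h21 h] Y0.
have inj i (x : Z i) : i2 i x = 0 -> x = 0 by move=> x0; rewrite -(h22 i x) x0 lfun0.
have le_i i : (dim (Z i) <= dim (X i))%N.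
  by rewrite (injective_dim (@inj i)) -dimvf dimvS ?subvf.
have [i Yi] : exists i, ~ forall y : Y i, y = 0.
  by apply: not_all_ex_not => Y0'; apply: Y0; apply/zero_objectE.
rewrite /rdim (bigD1 i) //= [X in (_ < X)%N](bigD1 i) //= -addSn leq_add //; last first.
  by apply: leq_sum => k _; apply: le_i.
rewrite (injective_dim (@inj i)) -dimvf ltnNge; apply/negP => le_d; apply: Yi => y.
have : i1 i y \in limg (i2 i).
  suff /eqP-> : limg (i2 i) == fullv by apply: memvf.
  by rewrite eqEdim subvf.
by move=> /memv_imgP[z _ yz]; rewrite -(h11 i y) yz h12.
Qed.

Lemma indecomposable_retract X : ~ zero_object X ->
  exists Y (i1 : hom Y X) (p1 : hom X Y), (forall i x, p1 i (i1 i x) = x) /\ indecomposable Y.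
Proof.
have [n] := ubnP (rdim X); elim: n X => // n IHn X leXn X0.
case: (classic (indecomposable X)) => [Xi|].
  by exists X, (idh X), (idh X); split=> // i x; rewrite !idhE.
move=> /not_and_or[//|/not_all_ex_not[Y /not_all_ex_not[Z nYZ]]].
have [YZ /not_or_and[Y0 Z0]] := imply_to_and _ _ nYZ.
have [i1 [i2 [p1 [p2 sum]]]] := proj1 (is_direct_sumE _ _ _) YZ.
have ltYX : (rdim Z < n)%N by apply: leq_trans (direct_sum_rdim sum Y0) _.
have [T [j [q [qj Ti]]]] := IHn _ ltYX Z0.
case: sum => _ h22 _ _ _.
by exists T, (comph i2 j), (comph q p2); split=> // i x; rewrite !comphE h22 qj.
Qed.

Lemma mem_iter_limg (V : vectType K) (f : 'End(V)) (A : {vspace V}) n y :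
  y \in iter n (lfun_img f) A <-> exists2 x, x \in A & y = iter n f x.
Proof.
elim: n y => [|n IHn] y /=; first by split=> [yA|[x xA ->]] //; exists y.
split=> [/memv_imgP[z /IHn[x xA ->] ->]|[x xA ->]]; first by exists x.
by apply: memv_img; apply/IHn; exists x.
Qed.

(** The images [f^n A] decrease, hence are eventually constant; comparing the
    [n]-th with the [2n]-th gives the statement. *)
Lemma iter_stable (V : vectType K) (f : 'End(V)) (A : {vspace V}) :
    (forall x, x \in A -> f x \in A) ->
  exists N, forall n, (N <= n)%N -> forall x, x \in A ->
    exists2 y, y \in A & iter n f x = iter n f (iter n f y).
Proof.
move=> fA; have [|N HN] := @iter_limg_stable K V f A.
  by apply/subvP => _ /memv_imgP[x /fA fx ->].
exists N => n leNn x xA.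
have : iter n f x \in iter (n + n) (lfun_img f) A.
  rewrite HN ?(leq_trans leNn) ?leq_addr // -(HN _ leNn).
  by apply/mem_iter_limg; exists x.
by move=> /mem_iter_limg[y yA ->]; exists y; rewrite // iterD.
Qed.

Lemma common_bound (I : finType) (P : I -> nat -> Prop) :
    (forall i, exists N, forall n, (N <= n)%N -> P i n) ->
  exists N, forall n, (N <= n)%N -> forall i, P i n.
Proof.
move=> /fin_all_exists[N HN]; exists (\max_i N i)%N => n leNn i.
by apply: HN; apply: leq_trans leNn; apply: leq_bigmax.
Qed.

(** For large [n] each space is the direct sum of the kernel and the image of
    [w = u^n], and so is each relation, which is mapped to itself by the pair of
    the two maps at its ends.  Hence the projections [e] onto the images form
    an idempotent endomorphism, which is [0] or the identity. *)
Lemma fitting X (u : hom X X) : indecomposable X ->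
  is_iso u \/ exists n, forall i x, iter n (u i) x = 0.
Proof.
move=> Xi.
have [N1 HN1] : exists N, forall n, (N <= n)%N -> forall (i : vertex E) (x : X i),
    exists y, iter n (u i) x = iter n (u i) (iter n (u i) y).
  apply: common_bound => i.
  have [|N HN] := @iter_stable _ (u i) fullv; first by move=> *; apply: memvf.
  by exists N => n /HN Hn x; have [y _ ->] := Hn x (memvf x); exists y.
have [N2 HN2] : exists N, forall n, (N <= n)%N ->
    forall (a : arrow E) (v : X (tail_of a)) (w : X (head_of a)), relx a v w ->
    exists v' w', [/\ relx a v' w', iter n (u _) v = iter n (u _) (iter n (u _) v')
                    & iter n (u _) w = iter n (u _) (iter n (u _) w')].
  apply: common_bound => a; pose p := pair_lfun (u (tail_of a)) (u (head_of a)).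
  have pE n x : iter n p x = (iter n (u _) x.1, iter n (u _) x.2).
    by elim: n => [|n /= ->]; rewrite ?pair_lfunE // -surjective_pairing.
  have [|N HN] := @iter_stable _ p (relat X a).
    by move=> [v w] vw; rewrite pair_lfunE; apply: hom_relat.
  exists N => n /HN Hn v w /relxE /Hn[[v' w'] v'w']; rewrite !pE /= => -[-> ->].
  by exists v', w'; split=> //; apply/relxE.
(* The exponent is positive so that the kernel of [u] lies in that of [w]. *)
pose n := (N1 + N2).+1.
have {}HN1 : forall i (x : X i), exists y, iter n (u i) x = iter n (u i) (iter n (u i) y).
  by apply: HN1; rewrite /n; lia.
have {}HN2 := HN2 n ltac:(rewrite /n; lia).
pose w := hom_iter u n; have wE i x : w i x = iter n (u i) x by apply: hom_iterE.
have ww0 i x : w i (w i x) = 0 -> w i x = 0.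
  have dimE : \dim (w i @: limg (w i)) = \dim (limg (w i)).
    apply: congr1; apply/eqP; rewrite eqEsubv limgS ?subvf //=.
    apply/subvP => _ /memv_imgP[z _ ->]; rewrite wE; have [y ->] := HN1 i z.
    by rewrite -!wE !memv_img ?memvf.
  have := limg_ker_dim (w i) (limg (w i)); rewrite dimE -[RHS]add0n.
  move=> /addIn/eqP; rewrite dimv_eq0 => /eqP ker0 wwx.
  by apply/eqP; rewrite -memv0 -ker0 memv_cap memv_ker wwx eqxx memv_img ?memvf.
(* [P i x y]: [y] is the component of [x] in the image of [w]. *)
pose P i (x y : X i) := (exists z, y = w i z) /\ w i (x - y) = 0.
have Plin i : lin_closed (fun p : (X i * X i)%type => P i p.1 p.2).
  split=> [|k [x y] [x' y'] /= [[z ->] xz] [[z' ->] xz']]; split.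
  + by exists 0; rewrite (lfun0 (w i)).
  + by apply: (etrans (congr1 (w i) (subrr _))); rewrite lfun0.
  + by exists (k *: z + z'); rewrite lfun_lin.
  by rewrite opprD addrACA -scalerBr lfun_lin xz xz' scaler0 addr0.
have Puniq i x y y' : P i x y -> P i x y' -> y = y'.
  move=> [[z ->] xz] [[z' ->] xz']; apply/eqP; rewrite -subr_eq0 -lfunB; apply/eqP/ww0.
  rewrite lfunB; have -> : w i z - w i z' = (x - w i z') - (x - w i z).
    by rewrite opprB [RHS]addrC addrA subrK.
  by rewrite lfunB /= xz xz' subrr.
have [e eP] : exists e : forall i, 'End(X i), forall i x, P i x (e i x).
  have /(_ _)/constructive_indefinite_description ex i :
      exists e : 'End(X i), forall x, P i x (e x).
    have [e eP] := linear_section (Plin i); exists e => x.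
    have [y xy] := HN1 i x; apply: (eP x (w i y)); split; first by exists y.
    by rewrite lfunB !wE xy subrr.
  by exists (fun i => sval (ex i)) => i; apply: (svalP (ex i)).
have eR a i j (v : X i) (w' : X j) : relx a v w' -> relx a (e i v) (e j w').
  move=> vw; have ei := relx_tail vw; have ej := relx_head vw.
  case: i / ei v vw; case: j / ej w' => v' v vw.
  have [v1 [w1 [v1w1 e1 e2]]] := HN2 _ _ _ vw.
  rewrite (Puniq _ _ _ (w _ v1) (eP _ v)) ?(Puniq _ _ _ (w _ w1) (eP _ v')).
  + exact: hom_relx.
  + by split; [exists w1 | rewrite lfunB !wE e2 subrr].
  by split; [exists v1 | rewrite lfunB !wE e1 subrr].
have [|e0|e1] := @indecomposable_idempotent X (mk_hom eR) Xi.
- move=> i x; apply: (Puniq _ (e i x)) (eP _ _) _; case: (eP i x) => ex _.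
  by split; rewrite // subrr lfun0.
- right; exists n => i x; rewrite -wE; have [_] := eP i x.
  by rewrite [e i x]e0 subr0.
left; apply: injective_endo_iso => i x ux.
have wx : w i x = 0 by rewrite wE /n iterSr ux; elim: (_ + _)%N => //= m ->; rewrite lfun0.
have Px0 : P i x 0 by split; [exists 0; rewrite lfun0 | rewrite subr0].
by rewrite -(Puniq _ _ _ _ (eP i x) Px0) [e i x]e1.
Qed.

Lemma iso_injective X Y (f : hom X Y) : is_iso f -> forall i x, f i x = 0 -> x = 0.
Proof. by move=> /is_isoE[g [gK _]] i x fx; rewrite -(gK i x) fx lfun0. Qed.

Lemma nilpotent_sub_iso X (u v : hom X X) n :
  (forall i x, iter n (v i) x = 0) -> (forall i x, u i x = x - v i x) -> is_iso u.
Proof.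
move=> v0 uE; apply: injective_endo_iso => i x; rewrite uE => /eqP; rewrite subr_eq0 => /eqP xv.
by rewrite -(v0 i x); elim: (n) => //= m <-.
Qed.

(** If [k u + v] has the left inverse [w], then [w v] is nilpotent or an
    isomorphism; in the first case [1 - w v = w (k u)] is an isomorphism.  So
    [u] or [v] is injective. *)
Lemma indecomposable_local X (u v : hom X X) (k : K) : indecomposable X ->
  ~ is_iso u -> ~ is_iso v -> ~ is_iso (lin_hom k u v).
Proof.
move=> Xi uN vN /is_isoE[w [wK Kw]].
have [/iso_injective inj|[n v0]] := fitting (comph w v) Xi.
  by case: vN; apply: injective_endo_iso => i x vx; apply: inj; rewrite comphE vx lfun0.
have /iso_injective inj : is_iso (comph w (lin_hom k u (zeroh X X))).
  apply: (nilpotent_sub_iso v0) => i x; rewrite !comphE -{2}(wK i x) -lfunB; congr (w i _).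
  by rewrite !lin_homE zero_lfunE addr0 addrK.
case: uN; apply: injective_endo_iso => i x ux; apply: inj.
by rewrite comphE lin_homE ux zero_lfunE scaler0 addr0 lfun0.
Qed.

End Summands.

(** * Right approximations of systems of arbitrary relations *)

Section Approximation.
Variables (K : fieldType) (E : equippedGraph).
Implicit Types X Y Z : rep K E.

(** One space into which all [X i] embed, so that cocycles, which are indexed by
    arrows, take values in a space that does not depend on the arrow. *)
Definition ambient X : vectType K := 'rV[K]_(\max_i dim (X i)).

Definition into_ambient X i : 'Hom(X i, ambient X) :=
  linfun (fun x => v2r x *m pid_mx (dim (X i)) : 'rV[K]_(\max_i dim (X i))).

Definition from_ambient X i : 'Hom(ambient X, X i) :=
  linfun (fun y : 'rV[K]_(\max_i dim (X i)) => r2v (y *m pid_mx (dim (X i)))).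

Lemma into_ambientK X i x : from_ambient X i (into_ambient X i x) = x.
Proof.
rewrite linear_lfunE => [|k u v]; last by rewrite mulmxDl -scalemxAl linearP.
rewrite linear_lfunE => [|k u v]; last by rewrite linearP /= mulmxDl -scalemxAl.
have le_i : (dim (X i) <= \max_i dim (X i))%N by apply: (@leq_bigmax _ (fun i => dim (X i))).
by rewrite -mulmxA pid_mx_id // pid_mx_1 mulmx1 v2rK.
Qed.

(** A system of relations of arbitrary types, with all its spaces inside a
    single one. *)
Record prerep := Prerep {
  presort : vectType K;
  prespace : vertex E -> {vspace presort};
  prerel : arrow E -> {vspace (presort * presort)%type};
  prerel_swap : forall a v w, (v, w) \in prerel a -> (w, v) \in prerel (star a)
}.

Implicit Types M N : prerep.

Definition prehom X M (t : forall i, 'Hom(X i, presort M)) : Prop :=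
  (forall i x, t i x \in prespace M i) /\
  (forall a i j (v : X i) (w : X j), relx a v w -> (t i v, t j w) \in prerel M a).

Definition ker_free M a : Prop :=
  forall v, v \in prespace M (tail_of a) -> (v, 0) \in prerel M a -> v = 0.

Definition dominates N M : Prop :=
  exists p : 'Hom(presort N, presort M),
  [/\ forall i v, v \in prespace N i -> p v \in prespace M i,
      forall a v w, (v, w) \in prerel N a -> (p v, p w) \in prerel M a
    & forall X t, prehom (X := X) (M := M) t ->
        exists t', prehom (X := X) (M := N) t' /\ forall i x, p (t' i x) = t i x].

Lemma dominates_refl M : dominates M M.
Proof.
exists \1%VF; split=> [i v|a v w|X t tM]; rewrite ?id_lfunE //.
by exists t; split=> // i x; rewrite id_lfunE.
Qed.

Lemma dominates_trans M N P : dominates P N -> dominates N M -> dominates P M.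
Proof.
move=> [q [qS qR qL]] [p [pS pR pL]]; exists (p \o q)%VF; split.
- by move=> i v vP; rewrite comp_lfunE pS ?qS.
- by move=> a v w vw; rewrite !comp_lfunE pR ?qR.
move=> X t /pL[t1 [/qL[t2 [t2P t21]] t1t]]; exists t2; split=> // i x.
by rewrite comp_lfunE t21.
Qed.

Lemma relx_inverse X a : ~~ phi a ->
  exists f : 'Hom(X (head_of a), X (tail_of a)), forall v w, relx a v w -> f w = v.
Proof.
move=> pa; have [R0 RP] := relx_closed X (erefl (tail_of a)) (erefl (head_of a)).
pose P (w : X (head_of a)) (v : X (tail_of a)) := relx a v w.
have Plin : lin_closed (fun p : (X (head_of a) * X (tail_of a))%type => P p.1 p.2).
  by split=> [|k p q]; [exact: R0 | exact: (RP k (p.2, p.1) (q.2, q.1))].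
have [f fP] := linear_section Plin; exists f => v w vw.
apply/eqP; rewrite -subr_eq0; apply/eqP/(relx_ker pa (j := head_of a)).
by rewrite -(subrr w); apply: relxB => //; apply: fP vw.
Qed.

(** Let [phi a = 0].  In a representation, the relation at [a] is the graph of
    a partial map from the head to the tail of [a].  So a map into [M] can be
    enlarged, at the head of [a], by a second coordinate that extends this
    partial map; demanding that this coordinate be the element at the tail
    makes the kernel at [a] trivial. *)
Section KillKernel.
Variables (M : prerep) (a : arrow E).
Hypotheses (pa : ~~ phi a) (a_loopfree : tail_of a != head_of a).

Let U2 : vectType K := (presort M * presort M)%type.

Let space_pred i (p : U2) := p.1 \in prespace M i /\ (i <> head_of a -> p.2 = 0).
Let rel_pred b (q : (U2 * U2)%type) :=
  [/\ (q.1.1, q.2.1) \in prerel M b, b = a -> q.2.2 = q.1.1 & b = star a -> q.1.2 = q.2.1].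

Let space_pred_lin i : lin_closed (space_pred i).
Proof.
split=> [|k p q [pS p0] [qS q0]]; first by split; rewrite // mem0v.
by split=> [|ni] /=; [rewrite rpredD // rpredZ | rewrite p0 ?q0 // scaler0 addr0].
Qed.

Let rel_pred_lin b : lin_closed (rel_pred b).
Proof.
split=> [|k p q [pR pa' pas] [qR qa qas]]; first by split=> //; apply: mem0v.
split=> [|/[dup] /pa' e /qa e'|/[dup] /pas e /qas e'] /=.
- by rewrite -[(_, _)]/(k *: (p.1.1, p.2.1) + (q.1.1, q.2.1)) rpredD // rpredZ.
- by rewrite e e'.
by rewrite e e'.
Qed.

Let kill_space i := vset (space_pred i).
Let kill_rel b := vset (rel_pred b).

Let mem_space i p : p \in kill_space i <-> space_pred i p.
Proof. exact: (mem_vset (space_pred_lin i)). Qed.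
Let mem_rel b q : q \in kill_rel b <-> rel_pred b q.
Proof. exact: (mem_vset (@rel_pred_lin b)). Qed.

Let kill_swap b v w : (v, w) \in kill_rel b -> (w, v) \in kill_rel (star b).
Proof.
move=> /mem_rel[vw va vas]; apply/mem_rel; split=> /= [|e|e].
- exact: prerel_swap.
- by apply: vas; rewrite -e starK.
by apply: va; rewrite -[b]starK e starK.
Qed.

Definition kill_kernel : prerep := Prerep kill_space kill_swap.

Lemma kill_kernel_dominates : dominates kill_kernel M.
Proof.
exists (fst_lfun _ _); split=> [i v /mem_space[vS _]|b v w /mem_rel[vw _ _]|X t [tS tR]].
- by rewrite fst_lfunE.
- by rewrite !fst_lfunE.
have [f fP] := relx_inverse X pa.
pose n i (x : X i) : presort M :=
  if i == head_of a then t _ (f (from_ambient X (head_of a) (into_ambient X i x))) else 0.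
have nlin i k (u v : X i) : n i (k *: u + v) = k *: n i u + n i v.
  by rewrite /n; case: eqP => _; rewrite ?lfun_lin // scaler0 addr0.
pose t' i : 'Hom(X i, U2) := linfun (fun x => (t i x, n i x) : U2).
have t'E i x : t' i x = (t i x, n i x).
  by rewrite linear_lfunE // => k u v; rewrite lfun_lin nlin.
have nE (v : X (tail_of a)) (w : X (head_of a)) : relx a v w -> n _ w = t _ v.
  by move=> vw; rewrite /n eqxx into_ambientK (fP _ _ vw).
have nR i j (v : X i) (w : X j) : relx a v w -> n _ w = t _ v.
  move=> vw; have ei := relx_tail vw; have ej := relx_head vw.
  by case: i / ei v vw; case: j / ej w => w v; apply: nE.
exists t'; split=> [|i x]; last by rewrite t'E fst_lfunE.
split=> [i x|b i j v w vw]; rewrite !t'E.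
  by apply/mem_space; split=> //= /eqP/negPf ni; rewrite /n ni.
apply/mem_rel; split=> /= [|e|e]; first exact: tR.
  by apply: nR; rewrite -e.
by apply: nR; apply/relx_star; rewrite -e.
Qed.

Lemma kill_kernel_ker_free : ker_free kill_kernel a.
Proof.
move=> [m n] /mem_space[_ n0] /mem_rel[/= _ /(_ erefl) m0 _].
have nt : n = 0 by apply: n0; apply/eqP.
by rewrite nt -m0.
Qed.

(** The second coordinate lives at the head of [a] only, so it can create a
    kernel only at arrows with this tail; at [star a] it is fixed by the
    relation. *)
Lemma kill_kernel_ker_free_other b : ker_free M b -> ~~ consecutive b a -> ker_free kill_kernel b.
Proof.
move=> Mb nba [m n] /mem_space[/= mS n0] /mem_rel[/= mb _ nb].
have m0 : m = 0 by apply: Mb.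
suff -> : n = 0 by rewrite m0.
case: (eqVneq b (star a)) => [/nb//|ba]; apply: n0; apply/eqP.
move: nba; rewrite /consecutive negb_and negbK => /orP[//|/eqP ab].
by move: ba; rewrite ab starK eqxx.
Qed.

End KillKernel.

Definition no_cycle_outside_Omega : Prop :=
  forall w : seq (arrow E), oriented_cycle w -> ~~ all (fun a => ~~ phi a) w.

(** Otherwise following a successor function inside [D] eventually runs around
    an oriented cycle. *)
Lemma exists_sink (D : {set arrow E}) : no_cycle_outside_Omega ->
    (forall a, a \in D -> ~~ phi a) -> D != set0 ->
  exists2 a, a \in D & forall b, b \in D -> ~~ consecutive b a.
Proof.
move=> nocycle D0 /set0Pn[d dD]; apply: NNPP => nosink.
have next a : exists b, a \in D -> b \in D /\ consecutive b a.
  case: (boolP (a \in D)) => [aD|_]; last by exists a.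
  apply: NNPP => nb; apply: nosink; exists a => // b bD; apply/negP => ba.
  by apply: nb; exists b.
have {}/fin_all_exists[f fP] := next.
have fD n : iter n f d \in D by elim: n => //= n /fP[].
have [m [n [lt_mn e]]] : exists m n, (m < n)%N /\ iter n f d = iter m f d.
  have : ~ injective (fun k : 'I_#|arrow E|.+1 => iter k f d).
    by move=> /leq_card; rewrite card_ord ltnn.
  move=> ninj; apply: NNPP => nex; apply: ninj => i j eij; apply: val_inj => /=.
  case: (ltngtP i j) => // lt_ij; case: nex.
    by exists i, j.
  by exists j, i.
pose y := iter m f d; pose k := (n - m).-1.
have yk : iter k.+1 f y = y.
  by rewrite /y -iterD /k -subn_gt0 in lt_mn *; rewrite prednK // subnK // ltnW // -subn_gt0.
have yD i : iter i f y \in D by rewrite /y -iterD.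
pose w := rev (traject f y k.+1).
have wD a : a \in w -> a \in D.
  by rewrite mem_rev => /trajectP[i _ ->].
have /nocycle/negP : oriented_cycle w.
  rewrite /oriented_cycle -size_eq0 size_rev size_traject /= /w rev_cycle.
  have yE : rcons (traject f (f y) k) y = traject f (f y) k.+1.
    by rewrite trajectSr -iterSr yk.
  rewrite trajectS /=. rewrite yE.
  have: fpath f y (traject f (f y) k.+1) by apply: fpath_traject.
  apply: (sub_in_path (P := mem D)) => [a b aD _ /eqP <-|]; first by case: (fP _ aD).
  by apply/allP => a; rewrite -trajectS => /trajectP[i _ ->]; apply: yD.
by case; apply/allP => a /wD/D0.
Qed.

(** Induction on the set of arrows already treated: a sink is treated last, as
    it then spoils none of the others. *)
Lemma dominates_ker_free M : no_cycle_outside_Omega ->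
  exists N, dominates N M /\ forall a, ~~ phi a -> ker_free N a.
Proof.
move=> nocycle.
suff kill_all n (D : {set arrow E}) : #|D| = n -> (forall a, a \in D -> ~~ phi a) ->
    exists N, dominates N M /\ forall a, a \in D -> ker_free N a.
  have [|N [NM Nk]] := kill_all _ [set a | ~~ phi a] erefl; first by move=> a; rewrite inE.
  by exists N; split=> // a pa; apply: Nk; rewrite inE.
elim: n D => [|n IHn] D cD D0.
  by exists M; split=> [|a]; [exact: dominates_refl | rewrite (cards0_eq cD) inE].
have [|a aD sink] := exists_sink nocycle D0; first by rewrite -card_gt0 cD.
have [||N [NM Nk]] := IHn (D :\ a).
- by move: cD; rewrite (cardsD1 a) aD => -[].
- by move=> b; rewrite inE => /andP[_ /D0].
have pa := D0 _ aD.
have loopfree : tail_of a != head_of a.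
  apply/negP => e; have /nocycle : oriented_cycle [:: a].
    by rewrite /oriented_cycle /= /consecutive e eq_sym star_neq.
  by rewrite /= pa.
exists (kill_kernel N a); split; first exact: dominates_trans (kill_kernel_dominates _ pa) NM.
move=> b bD; case: (eqVneq b a) => [->|ba]; first exact: kill_kernel_ker_free.
apply: kill_kernel_ker_free_other; last exact: sink.
by apply: Nk; rewrite !inE ba.
Qed.

(** While some element at the tail of an arrow with [phi] equal to 1 has no
    partner, the space there is cut down to the elements that have one; the
    image of a representation always lies in this subspace. *)
Lemma ker_free_approximation M : (forall a, ~~ phi a -> ker_free M a) ->
  exists (I : rep K E) (p : forall i, 'Hom(I i, presort M)), prehom p /\
    forall X t, prehom (X := X) (M := M) t ->
      exists g : hom X I, forall i x, p i (g i x) = t i x.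
Proof.
have [n] := ubnP (\sum_i \dim (prespace M i))%N; elim: n M => // n IHn M ltMn Mk.
pose good a v := exists2 w, w \in prespace M (head_of a) & (v, w) \in prerel M a.
case: (classic (forall a v, phi a -> v \in prespace M (tail_of a) -> good a v)) => [Mdef|].
  have Qfam : relation_family (V := fun i => subvs_of (prespace M i))
      (fun a i j v w => (vsval v, vsval w) \in prerel M a).
    split=> [a|a i j v w _ _|a i j v|a i j v ei _ pa].
    - split=> [|k u v uR vR]; first exact: mem0v.
      rewrite -[(_, _)]/(k *: (vsval u.1, vsval u.2) + (vsval v.1, vsval v.2)).
      by rewrite rpredD // rpredZ.
    - exact: prerel_swap.
    - move=> ei ej pa; case: i / ei v; case: j / ej => v.
      by have [w wS vw] := Mdef _ _ pa (subvsP v); exists (Subvs wS).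
    case: i / ei v => v v0; apply: subvs_inj.
    by apply: Mk v0 => //; apply: subvsP.
  pose I := mk_rep Qfam.
  pose p i : 'Hom(I i, presort M) := linfun (@vsval K _ (prespace M i)).
  have pE i x : p i x = vsval x by apply: lfunE.
  exists I, p; split.
    split=> [i x|a i j v w /relx_mk[_ _ vw]]; rewrite !pE //; exact: subvsP.
  move=> X t [tS tR].
  pose g i : 'Hom(X i, I i) := (linfun (@vsproj K _ (prespace M i)) \o t i)%VF.
  have gE i x : vsval (g i x) = t i x by rewrite comp_lfunE lfunE /= vsprojK ?tS.
  have gR a i j (v : X i) (w : X j) : relx a v w -> relx a (g i v) (g j w).
    move=> vw; apply/relx_mk; split; [exact: relx_tail vw | exact: relx_head vw|].
    by rewrite !gE; apply: tR.
  by exists (mk_hom gR) => i x; rewrite pE gE.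
move=> /not_all_ex_not[a /not_all_ex_not[v nav]].
have [pa nv] := imply_to_and _ _ nav; have [vS bad] := imply_to_and _ _ nv.
have good_lin : lin_closed (fun u => u \in prespace M (tail_of a) /\ good a u).
  split=> [|k u u' [uS [w wS uw]] [u'S [w' w'S u'w']]].
    by rewrite mem0v; split=> //; exists 0; apply: mem0v.
  split; first by rewrite rpredD // rpredZ.
  exists (k *: w + w'); first by rewrite rpredD // rpredZ.
  by rewrite -[(_, _)]/(k *: (u, w) + (u', w')) rpredD // rpredZ.
pose S i := if i == tail_of a then
  vset (fun u => u \in prespace M (tail_of a) /\ good a u) else prespace M i.
pose N := Prerep S (@prerel_swap M).
have sNM i : (prespace N i <= prespace M i)%VS.
  rewrite /= /S; case: eqP => [->|//].
  by apply/subvP => u /(mem_vset good_lin)[].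
have [||I [p [[pS pR] pL]]] := IHn N.
- rewrite -ltnS; apply: leq_trans ltMn; rewrite ltnS.
  rewrite (bigD1 (tail_of a)) //= [X in (_ < X)%N](bigD1 (tail_of a)) //= -addSn leq_add //.
    rewrite ltn_neqAle dimvS ?sNM // andbT; apply/negP => /eqP dE.
    have /eqP eS : prespace N (tail_of a) == prespace M (tail_of a) by rewrite eqEdim sNM dE /=.
    by move: vS; rewrite -eS /= /S eqxx => /(mem_vset good_lin)[_ /bad].
  by apply: leq_sum => i _; apply: dimvS; apply: sNM.
- by move=> b pb u /(subvP (sNM _)) uS; apply: Mk.
exists I, p; split; first by split=> [i x|//]; apply: (subvP (sNM i)).
move=> X t [tS tR]; apply: pL; split=> // i x; rewrite /= /S; case: eqP => [ei|_]; last exact: tS.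
apply/(mem_vset good_lin); rewrite -ei; split; first exact: tS.
have [w xw] := relx_def (j := head_of a) x pa (esym ei) erefl.
by exists (t _ w); [exact: tS | exact: tR].
Qed.

Lemma right_approximation M : no_cycle_outside_Omega ->
  exists (I : rep K E) (p : forall i, 'Hom(I i, presort M)), prehom p /\
    forall X t, prehom (X := X) (M := M) t ->
      exists g : hom X I, forall i x, p i (g i x) = t i x.
Proof.
move=> /(dominates_ker_free M)[N [[q [qS qR qL]] /ker_free_approximation[I [p [[pS pR] pL]]]]].
exists I, (fun i => (q \o p i)%VF); split.
  by split=> [i x|a i j v w vw]; rewrite !comp_lfunE; [apply: qS | apply: qR; apply: pR].
move=> X t /qL[t' [/pL[g gE] t'E]].
by exists g => i x; rewrite comp_lfunE gE.
Qed.

End Approximation.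

(** * Extensions from cocycles *)

Section Extensions.
Variables (K : fieldType) (E : equippedGraph).
Implicit Types X Y Z M : rep K E.

Lemma addr_sub_add (V : zmodType) (x y z t : V) : x + y - (z + t) = (x - z) + (y - t).
Proof. by rewrite opprD addrACA. Qed.

Definition ambient2 Z : vectType K := (ambient Z * ambient Z)%type.

Definition cocycle Z X : vectType K := {ffun arrow E -> 'Hom(ambient2 Z, ambient X)}.

(** The value of a cocycle on a pair over [Z].  The cocycle stands for the
    correction [(coc c a z z', coc c (star a) z' z)] of the pair [(z, z')],
    which is symmetric in [a] and [star a] by construction. *)
Definition coc Z X (c : cocycle Z X) a i j (z : Z i) (z' : Z j) : X i :=
  from_ambient X i (c a (into_ambient Z i z, into_ambient Z j z')).

Lemma coc_lin Z X k (c d : cocycle Z X) a i j (z : Z i) (z' : Z j) :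
  coc (k *: c + d) a z z' = k *: coc c a z z' + coc d a z z'.
Proof. by rewrite /coc !ffunE add_lfunE scale_lfunE lfun_lin. Qed.

Lemma coc_linr Z X (c : cocycle Z X) a i j k (z t : Z i) (z' t' : Z j) :
  coc c a (k *: z + t) (k *: z' + t') = k *: coc c a z z' + coc c a t t'.
Proof.
by rewrite /coc !lfun_lin pair_lin !lfun_lin.
Qed.

Lemma coc00 Z X (c : cocycle Z X) a i j : coc c a (0 : Z i) (0 : Z j) = 0.
Proof. by rewrite /coc !lfun0. Qed.

Definition splits_by Z X (c : cocycle Z X) (s : forall i, 'Hom(Z i, X i)) : Prop :=
  forall a i j (z : Z i) (z' : Z j), relx a z z' ->
    relx a (s i z - coc c a z z') (s j z' - coc c (star a) z' z).

Definition split Z X (c : cocycle Z X) : Prop := exists s, splits_by c s.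

Lemma split_closed Z X : lin_closed (@split Z X).
Proof.
split=> [|k c d [s cs] [t dt]].
  exists (fun i => 0) => a i j z z' zz'; rewrite !zero_lfunE !sub0r /coc !ffunE !zero_lfunE !lfun0.
  by rewrite !oppr0; apply: relx0; [exact: relx_tail zz' | exact: relx_head zz'].
exists (fun i => k *: s i + t i) => a i j z z' zz'.
rewrite !coc_lin !add_lfunE !scale_lfunE !addr_sub_add -!scalerBr.
by apply: relxP; [apply: cs | apply: dt].
Qed.

Section Extension.
Variables (Z X : rep K E) (c : cocycle Z X).

Lemma extension_family : relation_family (V := fun i => (X i * Z i)%type : vectType K)
  (fun a i j v w => relx a v.2 w.2 /\
     relx a (v.1 - coc c a v.2 w.2) (w.1 - coc c (star a) w.2 v.2)).
Proof.
split=> [a|a i j v w _ _ [zz xx]|a i j [x z] ei ej pa|a i j [x z] ei ej pa /= [z0]].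
- split=> [|k p q [/= p2 p1] [q2 q1]] /=.
    rewrite !coc00 !subr0; split; exact: relx0.
  split; first exact: relxP.
  by rewrite !coc_linr !addr_sub_add -!scalerBr; apply: relxP.
- by split; apply/relx_star; rewrite ?starK.
- have [z' zz'] := relx_def z pa ei ej.
  have [x' xx'] := relx_def (x - coc c a z z') pa ei ej.
  by exists (x' + coc c (star a) z' z, z'); rewrite /= addrK.
move: z0 => /(relx_ker pa) ->.
by rewrite !coc00 !subr0 => /(relx_ker pa) ->.
Qed.

Definition extension : rep K E := mk_rep extension_family.

Lemma relx_ext a i j (x : X i) (z : Z i) (x' : X j) (z' : Z j) :
  relx (X := extension) a ((x, z) : extension i) ((x', z') : extension j) <->
  relx a z z' /\ relx a (x - coc c a z z') (x' - coc c (star a) z' z).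
Proof.
rewrite relx_mk; split=> [[_ _]//|[zz' xx']].
by split=> //; [exact: relx_tail zz' | exact: relx_head zz'].
Qed.

Fact ext_inj_relx a i j (x : X i) (x' : X j) : relx a x x' ->
  relx (X := extension) a (inl_lfun (X i) (Z i) x) (inl_lfun (X j) (Z j) x').
Proof.
move=> xx'; rewrite !inl_lfunE; apply/relx_ext; rewrite !coc00 !subr0; split=> //.
by apply: relx0; [exact: relx_tail xx' | exact: relx_head xx'].
Qed.

Fact ext_proj_relx a i j (v : extension i) (w : extension j) : relx a v w ->
  relx a (snd_lfun (X i) (Z i) v) (snd_lfun (X j) (Z j) w).
Proof. by case: v w => [x z] [x' z'] /relx_ext[zz' _]; rewrite !snd_lfunE. Qed.

Definition ext_inj : hom X extension :=
  mk_hom (Y := extension) (f := fun i => inl_lfun (X i) (Z i)) ext_inj_relx.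
Definition ext_proj : hom extension Z :=
  mk_hom (X := extension) (f := fun i => snd_lfun (X i) (Z i)) ext_proj_relx.

Lemma ext_injE i x : ext_inj i x = (x, 0). Proof. exact: inl_lfunE. Qed.
Lemma ext_projE i v : ext_proj i v = v.2. Proof. exact: snd_lfunE. Qed.

Lemma ext_factor M (f : hom X M) (s : forall i, 'Hom(Z i, M i)) :
    (forall a i j (z : Z i) (z' : Z j), relx a z z' ->
       relx a (s i z - f i (coc c a z z')) (s j z' - f j (coc c (star a) z' z))) ->
  exists h : hom extension M, forall i x, h i (ext_inj i x) = f i x.
Proof.
move=> sR; pose h i : 'Hom(extension i, M i) :=
  ((f i \o fst_lfun (X i) (Z i)) - (s i \o snd_lfun (X i) (Z i)))%VF.
have hE i x z : h i (x, z) = f i x - s i z.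
  by rewrite /h add_lfunE opp_lfunE !comp_lfunE fst_lfunE snd_lfunE.
have hR a i j (v : extension i) (w : extension j) : relx a v w -> relx a (h i v) (h j w).
  case: v w => [x z] [x' z'] /relx_ext[/sR zz' /(hom_relx f) xx']; rewrite !hE.
  by have := relxB xx' zz'; rewrite !lfunB !opprB !addrA !subrK.
by exists (mk_hom hR) => i x; rewrite ext_injE hE lfun0 subr0.
Qed.

(** A vertexwise splitting [s] and a retraction [r] correspond to each other by
    [r (x, z) = x - s z]. *)
Lemma split_retract : split c <-> split_mono ext_inj.
Proof.
rewrite split_monoE; split=> [[s sc]|[r rK]].
  have [a i j z z' zz'|h hE] := @ext_factor X (idh X) s; first by rewrite !idhE; apply: sc.
  by exists h => i x; rewrite hE idhE.
exists (fun i => - (r i \o inr_lfun (X i) (Z i))%VF) => a i j z z' zz'.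
have /(hom_relx r) : relx (X := extension) a (coc c a z z', z) (coc c (star a) z' z, z').
  apply/relx_ext; rewrite !subrr; split=> //.
  by apply: relx0; [exact: relx_tail zz' | exact: relx_head zz'].
have rE k x t : r k (x, t) = x + r k (inr_lfun (X k) (Z k) t).
  rewrite -{2}(rK k x) -lfunD inr_lfunE ext_injE; congr (r k _).
  by congr pair; rewrite /= ?addr0 ?add0r.
rewrite !rE => /(relxZ (-1)); rewrite !scaleN1r !opprD !opp_lfunE !comp_lfunE.
by rewrite ![- coc _ _ _ _ + _]addrC.
Qed.

End Extension.

Definition push Z X M (f : hom X M) (c : cocycle Z X) : cocycle Z M :=
  [ffun a =>
    (into_ambient M (tail_of a) \o (f (tail_of a) \o from_ambient X (tail_of a)) \o c a)%VF].

Lemma coc_push Z X M (f : hom X M) (c : cocycle Z X) a i j (z : Z i) (z' : Z j) :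
  tail_of a = i -> coc (push f c) a z z' = f i (coc c a z z').
Proof. by move=> e; case: i / e z => z; rewrite /coc ffunE !comp_lfunE into_ambientK. Qed.

Definition pull Z X M (u : hom M Z) (c : cocycle Z X) : cocycle M X :=
  [ffun a => (c a \o pair_lfun
    (into_ambient Z (tail_of a) \o (u (tail_of a) \o from_ambient M (tail_of a)))
    (into_ambient Z (head_of a) \o (u (head_of a) \o from_ambient M (head_of a))))%VF].

Lemma coc_pull Z X M (u : hom M Z) (c : cocycle Z X) a i j (z : M i) (z' : M j) :
  tail_of a = i -> head_of a = j -> coc (pull u c) a z z' = coc c a (u i z) (u j z').
Proof.
move=> e e'; case: i / e z => z; case: j / e' z' => z'.
by rewrite /coc ffunE comp_lfunE pair_lfunE /= !comp_lfunE !into_ambientK.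
Qed.

(** The universal property of the pushout of the extension along [f]. *)
Lemma ext_factor_push Z X M (f : hom X M) (c : cocycle Z X) : split (push f c) ->
  exists h : hom (extension c) M, forall i x, h i (ext_inj c i x) = f i x.
Proof.
move=> [s sc]; apply: (ext_factor (s := s)) => a i j z z' zz'.
have := sc _ _ _ _ _ zz'; rewrite !coc_push //; last exact: relx_tail zz'.
by rewrite tail_of_star; apply: relx_head zz'.
Qed.

(** * The bilinear pairing *)

Section Pairing.
Variable Z : rep K E.

Definition arrow_space a : {vspace ambient2 Z} :=
  (pair_lfun (into_ambient Z (tail_of a)) (into_ambient Z (head_of a)) @: relat Z a)%VS.

Lemma mem_arrow_space a p : p \in arrow_space a <->
  exists i j (z : Z i) (z' : Z j), relx a z z' /\ p = (into_ambient Z i z, into_ambient Z j z').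
Proof.
split=> [/memv_imgP[[z z'] zz' ->]|[i [j [z [z' [[e1 [e2 zz']] ->]]]]]].
  by exists _, _, z, z'; rewrite pair_lfunE; split=> //; apply/relxE.
case: i / e1 z zz'; case: j / e2 z' => z' z /= zz'.
by apply/memv_imgP; exists (z, z'); rewrite ?pair_lfunE.
Qed.

Definition swap2 : 'End(ambient2 Z) := swap_lfun (ambient Z) (ambient Z).

Lemma swap2E x y : swap2 (x, y) = (y, x).
Proof. exact: swap_lfunE. Qed.

Lemma swap2K : (swap2 \o swap2)%VF = \1%VF.
Proof. by apply/lfunP => -[x y]; rewrite comp_lfunE !swap_lfunE id_lfunE. Qed.

Lemma arrow_space_swap a p : p \in arrow_space (star a) -> swap2 p \in arrow_space a.
Proof.
move=> /mem_arrow_space[i [j [z [z' [/relx_swap zz' ->]]]]]; apply/mem_arrow_space.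
by rewrite starK in zz'; exists j, i, z', z; rewrite swap_lfunE.
Qed.

Definition extdual_sort : vectType K := {ffun arrow E -> ambient2 Z}.

(** The space at [i] is the kernel of the sum of the projections, to the space
    of [Z] at [i], of the relations of [Z] at the arrows with tail [i]. *)
Definition extdual_space i (u : extdual_sort) : Prop :=
  [/\ forall a, tail_of a <> i -> u a = 0, forall a, tail_of a = i -> u a \in arrow_space a
    & \sum_(a | tail_of a == i) (u a).1 = 0].

(** The two ends of [a] contribute to the same relation of [Z]; on a pair in
    the relation of [X] these contributions cancel. *)
Definition extdual_rel a (p : (extdual_sort * extdual_sort)%type) : Prop :=
  p.1 a + swap2 (p.2 (star a)) = 0.

Lemma extdual_space_closed i : lin_closed (extdual_space i).
Proof.
split=> [|k u v [u0 ui us] [v0 vi vs]].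
  by split=> [a _|a _|]; rewrite ?ffunE ?mem0v // big1 // => a _; rewrite ffunE.
split=> [a na|a ea|].
- by rewrite !ffunE u0 // v0 // scaler0 addr0.
- by rewrite !ffunE rpredD ?vi // rpredZ ?ui.
under eq_bigr => a _ do rewrite !ffunE /=.
by rewrite big_split /= -scaler_sumr us vs scaler0 addr0.
Qed.

Lemma extdual_rel_closed a : lin_closed (extdual_rel a).
Proof.
split=> [|k p q]; rewrite /extdual_rel; first by rewrite /= !ffunE lfun0 addr0.
move=> pR qR; rewrite /= !ffunE lfun_lin addrACA -scalerDr.
by rewrite -/(p.1 a) pR qR scaler0 addr0.
Qed.

Lemma extdual_rel_swap a v w : (v, w) \in vset (extdual_rel a) ->
  (w, v) \in vset (extdual_rel (star a)).
Proof.
move=> /(mem_vset (extdual_rel_closed a)) vw; apply/(mem_vset (extdual_rel_closed (star a))).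
move: vw; rewrite /extdual_rel /= starK => /(congr1 swap2); rewrite lfunD lfun0.
by rewrite -[swap2 (swap2 _)]comp_lfunE swap2K id_lfunE addrC.
Qed.

Definition extdual : prerep K E := Prerep (fun i => vset (extdual_space i)) extdual_rel_swap.

Lemma mem_extdual_space i u : u \in prespace extdual i <-> extdual_space i u.
Proof. exact: (mem_vset (extdual_space_closed i)). Qed.

Lemma mem_extdual_rel a u v : (u, v) \in prerel extdual a <-> u a + swap2 (v (star a)) = 0.
Proof. exact: (mem_vset (extdual_rel_closed a) (u, v)). Qed.

Definition eval_at a : 'Hom(extdual_sort, ambient2 Z) := linfun (fun u : extdual_sort => u a).

Lemma eval_atE a u : eval_at a u = u a.
Proof. by rewrite linear_lfunE // => k v w; rewrite !ffunE. Qed.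

Section PairingOn.
Variable X : rep K E.
Implicit Types (t : forall i, 'Hom(X i, extdual_sort)) (c : cocycle Z X).

Definition component t a : 'Hom(ambient X, ambient2 Z) :=
  (eval_at a \o (t (tail_of a) \o from_ambient X (tail_of a)))%VF.

Lemma componentE t a x : component t a x = t (tail_of a) (from_ambient X _ x) a.
Proof. by rewrite !comp_lfunE eval_atE. Qed.

(** The linear form on cocycles that a map to [extdual Z] induces. *)
Definition pairing t : 'Hom(cocycle Z X, K^o) :=
  linfun (fun c : cocycle Z X => \sum_a ltrace (component t a \o c a)%VF : K^o).

Lemma pairingE t c : pairing t c = \sum_a ltrace (component t a \o c a)%VF.
Proof.
rewrite linear_lfunE // => k d e; rewrite scaler_sumr -big_split /=.
apply: eq_bigr => a _; rewrite !ffunE -linearP; congr ltrace.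
by rewrite comp_lfunDr comp_lfunZr.
Qed.

Lemma pairing_eq t t' c : (forall i x, t i x = t' i x) -> pairing t c = pairing t' c.
Proof.
move=> tt'; rewrite !pairingE; apply: eq_bigr => a _; congr ltrace.
by apply/lfunP => y; rewrite [LHS]comp_lfunE [RHS]comp_lfunE !componentE tt'.
Qed.

Lemma pairing_lin k t t' t'' c : (forall i x, t i x = k *: t' i x + t'' i x) ->
  pairing t c = k *: pairing t' c + pairing t'' c.
Proof.
move=> tE; rewrite !pairingE scaler_sumr -big_split; apply: eq_bigr => a _ /=.
rewrite -linearP; congr ltrace; apply/lfunP => y.
by rewrite add_lfunE scale_lfunE !comp_lfunE !eval_atE tE !ffunE.
Qed.

End PairingOn.

Lemma pairing_push X M (f : hom X M) (t : forall i, 'Hom(M i, extdual_sort)) (c : cocycle Z X) :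
  pairing t (push f c) = pairing (fun i => (t i \o f i)%VF) c.
Proof.
rewrite !pairingE; apply: eq_bigr => a _; congr ltrace; apply/lfunP => y.
rewrite /push ffunE !comp_lfunE; congr (eval_at _ (t _ _)); exact: into_ambientK.
Qed.

End Pairing.
End Extensions.

Section PairingKernel.
Variables (K : fieldType) (E : equippedGraph).
Implicit Types X Y Z M : rep K E.

(** An orientation: exactly one of [a] and [star a] is positive. *)
Definition positive (a : arrow E) : bool := (enum_rank a < enum_rank (star a))%N.

Lemma positive_star a : positive (star a) = ~~ positive a.
Proof.
rewrite /positive starK -leqNgt ltn_neqAle.
case: eqP => [/ord_inj/enum_rank_inj e|//].
by have := star_neq a; rewrite e eqxx.
Qed.

(** Pairing [a] with [star a] uses an orientation, as [2] may be zero in [K]. *)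
Lemma sum_star (V : zmodType) (f : arrow E -> V) :
  (forall a, f a + f (star a) = 0) -> \sum_a f a = 0.
Proof.
move=> f0; rewrite (bigID positive) /=.
rewrite [X in _ + X](reindex_inj (inv_inj (@starK E))) /=.
under [X in _ + X]eq_bigl => a do rewrite positive_star negbK.
by rewrite -big_split big1 // => a _; apply: f0.
Qed.

(** With [P] a projection onto [A], [f = f (1 - P)] has the trace of
    [(1 - P) f = 0]. *)
Lemma ltrace_square0 (V : vectType K) (A : {vspace V}) (f : 'End(V)) :
  (forall v, f v \in A) -> (forall v, v \in A -> f v = 0) -> ltrace f = 0.
Proof.
move=> fA f0; pose P := projv A.
have -> : f = (f \o (\1 - P))%VF.
  apply/lfunP => v; rewrite comp_lfunE add_lfunE opp_lfunE id_lfunE lfunB.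
  by rewrite (f0 (P v)) ?subr0 // memv_proj.
rewrite ltraceC; have -> : ((\1 - P) \o f)%VF = 0.
  apply/lfunP => v; rewrite comp_lfunE add_lfunE opp_lfunE id_lfunE zero_lfunE.
  by rewrite projv_id ?subrr.
exact: ltrace0.
Qed.

(** Write [c a] as the coboundary of [s], which is [sg a], plus a remainder.
    The coboundary contributes the trace of a sum that vanishes at each vertex
    by the definition of the spaces of [extdual Z].  The remainder has values in
    the relations of [X], so its contributions [k a] and [k (star a)] cancel on
    the relation of [Z] at [a], which also contains their values. *)
Lemma pairing_split Z X (t : forall i, 'Hom(X i, extdual_sort Z)) (c : cocycle Z X) :
  prehom (M := extdual Z) t -> split c -> pairing t c = 0.
Proof.
move=> [tS tR] [s sc]; rewrite pairingE.
have tS' i x : extdual_space i (t i x) by apply/mem_extdual_space; apply: tS.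
pose r i : 'Hom(ambient Z, X i) := (s i \o from_ambient Z i)%VF.
pose sg a : 'Hom(ambient2 Z, ambient X) :=
  (into_ambient X (tail_of a) \o r (tail_of a) \o fst_lfun (ambient Z) (ambient Z))%VF.
pose k a : 'End(ambient2 Z) := (component t a \o (c a - sg a))%VF.
have cE a : ltrace (component t a \o c a)%VF =
    ltrace (component t a \o sg a)%VF + ltrace (k a).
  by rewrite -linearD -comp_lfunDr addrC subrK.
rewrite (eq_bigr _ (fun a _ => cE a)) big_split /=.
have fromK i (z : Z i) : from_ambient Z i (into_ambient Z i z) = z := into_ambientK _.
have sgE a i (z : Z i) (p : ambient Z) : tail_of a = i ->
    sg a (into_ambient Z i z, p) = into_ambient X i (s i z).
  by move=> e; case: i / e z => z; rewrite !comp_lfunE fst_lfunE fromK.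
have kE a i j (z : Z i) (z' : Z j) : relx a z z' ->
    k a (into_ambient Z i z, into_ambient Z j z') = - t i (s i z - coc c a z z') a.
  move=> /relx_tail e; case: i / e z => z; rewrite comp_lfunE componentE.
  rewrite add_lfunE opp_lfunE sgE // !lfunB into_ambientK /coc.
  by rewrite -[_ - _ in LHS]opprB [LHS]ffunE.
have k_mem a p : k a p \in arrow_space Z a.
  rewrite comp_lfunE componentE.
  by case: (tS' _ (from_ambient X (tail_of a) ((c a - sg a) p))) => _ ->.
have k_pair a p : p \in arrow_space Z a -> k a p + swap2 Z (k (star a) (swap2 Z p)) = 0.
  move=> /mem_arrow_space[i [j [z [z' [zz' ->]]]]].
  rewrite swap2E (kE _ _ _ _ _ zz') (kE _ _ _ _ _ (relx_swap zz')) linearN -opprD.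
  by have /tR/mem_extdual_rel -> := sc _ _ _ _ _ zz'; rewrite oppr0.
rewrite [X in _ + X]sum_star => [|a].
  rewrite addr0 (partition_big (@tail_of E) predT) //= big1 // => i _.
  have gE a : tail_of a == i -> ltrace (component t a \o sg a)%VF =
      ltrace (fst_lfun (ambient Z) (ambient Z) \o eval_at Z a \o (t i \o r i))%VF.
    move=> /eqP e; case: i / e; rewrite /sg !comp_lfunA ltraceC; congr ltrace.
    by apply/lfunP => p; rewrite !comp_lfunE into_ambientK.
  rewrite (eq_bigr _ gE) -linear_sum /=; set f := \sum_(a | _) _.
  suff -> : f = 0 by exact: ltrace0.
  apply/lfunP => p; rewrite sum_lfunE zero_lfunE.
  have hE a : (fst_lfun (ambient Z) (ambient Z) \o eval_at Z a \o (t i \o r i))%VF p =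
      (t i (r i p) a).1 by rewrite !comp_lfunE fst_lfunE eval_atE.
  apply: (etrans (eq_bigr _ (fun a _ => hE a))).
  by case: (tS' i (r i p)).
have kkE p : (k a + (swap2 Z \o (k (star a) \o swap2 Z)))%VF p =
    k a p + swap2 Z (k (star a) (swap2 Z p)).
  by rewrite add_lfunE; congr (_ + _); rewrite 2!comp_lfunE.
have : ltrace (k a + (swap2 Z \o (k (star a) \o swap2 Z)))%VF = 0.
  apply: (@ltrace_square0 _ (arrow_space Z a)) => p; rewrite kkE; last exact: k_pair.
  by apply: memvD; [apply: k_mem | apply: arrow_space_swap; apply: k_mem].
by rewrite ltraceD ltraceC -comp_lfunA swap2K comp_lfun1r.
Qed.

(** A form [L] vanishing on split cocycles is a sum of traces against maps [F a].
    That the [F a] define a map to [extdual Z] is read off from three kinds of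
    split cocycles built from rank one maps: those vanishing on a relation of
    [Z], the coboundaries, and those with values in a relation of [X]. *)
Lemma pairing_separates Z X (c : cocycle Z X) : ~ split c ->
  exists t, prehom (M := extdual Z) t /\ pairing t c <> 0.
Proof.
move=> nc; pose B := vset (@split K E Z X).
have memB d : d \in B <-> split d by apply: (mem_vset (@split_closed K E Z X)).
have [|L [LB Lc]] := @separation K _ B c; first by apply/negP => /memB.
have {}LB d : split d -> L d = 0 by move=> /memB/LB.
pose at_arrow a : 'Hom('Hom(ambient2 Z, ambient X), cocycle Z X) :=
  linfun (fun g => [ffun b => if b == a then g else 0] : cocycle Z X).
have at_arrowE a g : at_arrow a g = [ffun b => if b == a then g else 0].
  rewrite linear_lfunE // => k u v; apply/ffunP => b; rewrite !ffunE.
  by case: eqP; rewrite ?scaler0 ?addr0.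
have /fin_all_exists[F FL] a := ltrace_dual (L \o at_arrow a)%VF.
have LE d : L d = \sum_a ltrace (F a \o d a)%VF.
  have {1}-> : d = \sum_a at_arrow a (d a).
    apply/ffunP => b; rewrite sum_ffunE (bigD1 b) //= at_arrowE ffunE eqxx.
    by rewrite big1 ?addr0 // => a ab; rewrite at_arrowE ffunE eq_sym (negPf ab).
  by rewrite linear_sum; apply: eq_bigr => a _; rewrite -FL comp_lfunE.
pose tf i (x : X i) : extdual_sort Z :=
  [ffun a => if tail_of a == i then F a (into_ambient X i x) else 0].
pose t i : 'Hom(X i, extdual_sort Z) := linfun (@tf i).
have tE i x a : t i x a = if tail_of a == i then F a (into_ambient X i x) else 0.
  rewrite linear_lfunE ?ffunE // => k u v; apply/ffunP => b; rewrite !ffunE.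
  by case: eqP; rewrite ?scaler0 ?addr0 // !lfun_lin.
have at_outer a (l : 'Hom(ambient2 Z, K^o)) w : L (at_arrow a (outer l w)) = l (F a w).
  by rewrite -[L _]comp_lfunE FL ltrace_outer.
have coc_at a b (l : 'Hom(ambient2 Z, K^o)) w i j (z : Z i) (z' : Z j) :
    coc (at_arrow b (outer l w)) a z z' =
    if a == b then l (into_ambient Z i z, into_ambient Z j z') *: from_ambient X i w else 0.
  by rewrite /coc at_arrowE ffunE; case: eqP; rewrite ?zero_lfunE ?lfun0 // outerE lfunZ.
have relx00 b i j (z : Z i) (z' : Z j) : relx b z z' -> relx b (0 - 0 : X i) (0 - 0 : X j).
  by move=> zz'; rewrite !subr0; apply: relx0; [exact: relx_tail zz' | exact: relx_head zz'].
have outer_split a (l : 'Hom(ambient2 Z, K^o)) w :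
    (forall p, p \in arrow_space Z a -> l p = 0) -> split (at_arrow a (outer l w)).
  move=> l0; exists (fun i => 0) => b i j z z' zz'; rewrite !zero_lfunE.
  suff z0 b' i' j' (u : Z i') (u' : Z j') : relx b' u u' ->
      coc (at_arrow a (outer l w)) b' u u' = 0.
    by rewrite !z0 //; [exact: relx00 zz' | exact: relx_swap].
  move=> uu'; rewrite coc_at; case: eqP => // e.
  by rewrite l0 ?scale0r //; apply/mem_arrow_space; exists i', j', u, u'; rewrite -e.
exists t; split; last first.
  (* [c] and its image under the projection to [X] inside the ambient space have
     the same values, so [L] does not distinguish them. *)
  suff -> : pairing t c = L c by rewrite Lc; apply/eqP/oner_neq0.
  have -> : L c = L (push (idh X) c).
    apply/eqP; rewrite eq_sym -subr_eq0 -opprB -lfunB oppr_eq0; apply/eqP; apply: LB.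
    rewrite addrC -scaleN1r; exists (fun i => 0) => b i j z z' zz'.
    rewrite !zero_lfunE !coc_lin.
    rewrite !coc_push ?tail_of_star; [|exact: relx_head zz'|exact: relx_tail zz'].
    by rewrite !idhE !scaleN1r !addNr; apply: relx00 zz'.
  rewrite pairingE LE; apply: eq_bigr => a _; congr ltrace; apply/lfunP => p.
  transitivity (component t a (c a p)); first exact: comp_lfunE.
  rewrite componentE tE eqxx [RHS]comp_lfunE; congr (F a _).
  by rewrite /push ffunE !comp_lfunE id_lfunE.
split=> [i x|a i j x x' xx'].
  apply/mem_extdual_space; split=> [a /eqP/negPf ni|a ei|].
  - by rewrite tE ni.
  (* First kind: [l] vanishes on the relation of [Z] at [a]. *)
  - rewrite tE ei eqxx; apply/negPn/negP => /separation[l [l0 l1]].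
    have l2 : l (F a (into_ambient X i x)) = 0.
      by rewrite -at_outer; apply: LB; apply: outer_split.
    by move/eqP: l1; rewrite l2 eq_sym oner_eq0.
  apply/eqP; rewrite -memv0; apply/negPn/negP => /separation[m [_ m1]].
  (* Second kind: the coboundary of the rank one map [z |-> m z *: x] at [i]. *)
  pose m1l : 'Hom(ambient2 Z, K^o) := (m \o fst_lfun (ambient Z) (ambient Z))%VF.
  pose d : cocycle Z X :=
    [ffun a => if tail_of a == i then outer m1l (into_ambient X i x) else 0].
  have : L d = 0.
    apply: LB; pose sf k (z : Z k) : X k := if k == i
      then m (into_ambient Z k z) *: from_ambient X k (into_ambient X i x) else 0.
    pose s k : 'Hom(Z k, X k) := linfun (@sf k).
    have sE k z : s k z = if k == i
        then m (into_ambient Z k z) *: from_ambient X k (into_ambient X i x) else 0.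
      rewrite linear_lfunE // => b u v; rewrite /sf; case: eqP => _; last by rewrite scaler0 addr0.
      by rewrite !lfun_lin scalerDl scalerA.
    have dE b k k' (z : Z k) (z' : Z k') : tail_of b = k -> coc d b z z' = s k z.
      move=> e; rewrite sE /coc ffunE e; case: eqP => _; last by rewrite zero_lfunE lfun0.
      by rewrite outerE lfunZ comp_lfunE fst_lfunE.
    exists s => b k k' z z' zz'.
    rewrite !dE ?tail_of_star ?(relx_tail zz') ?(relx_head zz') // !subrr.
    by apply: relx0; [exact: relx_tail zz' | exact: relx_head zz'].
  rewrite LE (bigID (fun a => tail_of a == i)) /= [X in _ + X]big1 => [|a /negPf ni]; last first.
    by rewrite ffunE ni comp_lfun0r ltrace0.
  rewrite addr0; have -> : \sum_(a | tail_of a == i) ltrace (F a \o d a)%VF =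
      m (\sum_(a | tail_of a == i) (t i x a).1).
    rewrite linear_sum; apply: eq_bigr => a ei; rewrite ffunE ei ltrace_outer.
    by rewrite comp_lfunE fst_lfunE tE ei.
  by rewrite m1 => /eqP; rewrite oner_eq0.
apply/mem_extdual_rel; have ei := relx_tail xx'; have ej := relx_head xx'.
rewrite !tE tail_of_star ei ej !eqxx.
apply/eqP; rewrite -memv0; apply/negPn/negP => /separation[l [_ l1]].
(* Third kind: values proportional to the pair [(x, x')] in the relation of [X]. *)
pose d := at_arrow a (outer l (into_ambient X i x)) +
  at_arrow (star a) (outer (l \o swap2 Z)%VF (into_ambient X j x')).
have : L d = 0.
  apply: LB; exists (fun k => 0) => b k k' z z' zz'; rewrite !zero_lfunE.
  have dE b' i' j' (u : Z i') (u' : Z j') : coc d b' u u' =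
     coc (at_arrow a (outer l (into_ambient X i x))) b' u u' +
     coc (at_arrow (star a) (outer (l \o swap2 Z)%VF (into_ambient X j x'))) b' u u'.
    by rewrite -[d]/(_ + _) -[at_arrow a _]scale1r coc_lin !scale1r.
  rewrite !dE !coc_at (inj_eq (inv_inj (@starK E))) !comp_lfunE !swap2E.
  have -> : (star b == a) = (b == star a) by rewrite -[a in LHS]starK (inj_eq (inv_inj (@starK E))).
  case: (eqVneq b a) => [ba|ba].
    move: (relx_tail zz') (relx_head zz'); rewrite ba ei ej => ek ek'.
    case: k / ek z zz' => z zz'; case: k' / ek' z' zz' => z' zz'.
    rewrite eq_sym (negPf (star_neq a)) addr0 !add0r !into_ambientK -!scaleNr.
    exact: relxZ.
  case: (eqVneq b (star a)) => [bsa|bsa]; last by rewrite !addr0; apply: relx00 zz'.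
  move: (relx_tail zz') (relx_head zz'); rewrite bsa tail_of_star head_of_star ei ej => ek ek'.
  case: k / ek z zz' => z zz'; case: k' / ek' z' zz' => z' zz'.
  rewrite addr0 !add0r !into_ambientK -!scaleNr.
  by apply: relxZ; apply: relx_swap.
by rewrite lfunD !at_outer comp_lfunE -lfunD l1 => /eqP; rewrite oner_eq0.
Qed.

End PairingKernel.

(** * Exact sequences *)

Section ExactSequences.
Variables (K : fieldType) (E : equippedGraph).
Implicit Types X Y Z M : rep K E.

Lemma short_exactE (U V W : vectType K) (f : 'Hom(U, V)) (g : 'Hom(V, W))
    (A : {vspace U}) (B : {vspace V}) (C : {vspace W}) :
  short_exact f g A B C <->
  [/\ forall x, x \in A -> f x = 0 -> x = 0,
      forall x, x \in A -> f x \in B /\ g (f x) = 0,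
      forall y, y \in B -> g y = 0 -> exists2 x, x \in A & f x = y,
      forall y, y \in B -> g y \in C
    & forall z, z \in C -> exists2 y, y \in B & g y = z].
Proof.
split=> [[e1 e2 e3]|[h1 h2 h3 h4 h5]]; split.
- by move=> x xA fx; apply/eqP; rewrite -memv0 -e1 memv_cap xA memv_ker fx eqxx.
- move=> x xA; have : f x \in (B :&: lker g)%VS by rewrite -e2 memv_img.
  by rewrite memv_cap memv_ker => /andP[-> /eqP->].
- move=> y yB gy; have : y \in (f @: A)%VS by rewrite e2 memv_cap yB memv_ker gy eqxx.
  by move=> /memv_imgP[x xA ->]; exists x.
- by move=> y yB; rewrite -e3 memv_img.
- by move=> z; rewrite -e3 => /memv_imgP[y yB ->]; exists y.
- apply/eqP; rewrite -subv0; apply/subvP => x; rewrite memv_cap memv_ker memv0.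
  by move=> /andP[xA /eqP fx]; rewrite (h1 x).
- apply/vspaceP => y; rewrite memv_cap memv_ker; apply/memv_imgP/andP.
    by move=> [x xA ->]; have [-> ->] := h2 _ xA.
  by move=> [yB /eqP/h3[]// x xA <-]; exists x.
apply/vspaceP => z; apply/memv_imgP/idP => [[y yB ->]|/h5[y yB <-]]; first exact: h4.
by exists y.
Qed.

Lemma exact_seqE X Y Z (f : hom X Y) (g : hom Y Z) : exact_seq f g <->
  [/\ forall i x, f i x = 0 -> x = 0,
      forall i x, g i (f i x) = 0,
      forall i y, g i y = 0 -> exists x, f i x = y,
      forall i z, exists y, g i y = z
    & (forall a i j (x : X i) (x' : X j), relx a (f i x) (f j x') -> relx a x x') /\
      (forall a i j (z : Z i) (z' : Z j), relx a z z' ->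
         exists y y', [/\ relx a y y', g i y = z & g j y' = z'])].
Proof.
split=> [[hv ha]|[finj gf ker gsurj [krel grel]]]; last first.
  split=> [i|a]; apply/short_exactE; split=> //.
  - by move=> x _; apply: finj.
  - by move=> x _; rewrite memvf gf.
  - by move=> y _ /ker[x <-]; exists x; rewrite ?memvf.
  - by move=> y _; rewrite memvf.
  - by move=> z _; have [y <-] := gsurj i z; exists y; rewrite ?memvf.
  - move=> [x x'] _; rewrite pair_lfunE /= => e.
    by rewrite (finj _ _ (congr1 fst e)) (finj _ _ (congr1 snd e)).
  - by move=> [x x'] xx'; rewrite !pair_lfunE /= !gf; split; first exact: hom_relat.
  - move=> [y y'] /relxE yy'; rewrite pair_lfunE /= => e.
    have [x xy] := ker _ _ (congr1 fst e); have [x' xy'] := ker _ _ (congr1 snd e).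
    exists (x, x'); last by rewrite pair_lfunE /= xy xy'.
    by apply/relxE; apply: krel; rewrite xy xy'.
  - by move=> [y y'] yy'; rewrite pair_lfunE; apply: hom_relat.
  move=> [z z'] /relxE/grel[y [y' [/relxE yy' yz yz']]].
  by exists (y, y') => //; rewrite pair_lfunE /= yz yz'.
have finj i x : f i x = 0 -> x = 0.
  by have /short_exactE[h _ _ _ _] := hv i; apply: h; apply: memvf.
split=> //.
- by move=> i x; have /short_exactE[_ h _ _ _] := hv i; case: (h x (memvf x)).
- move=> i y gy; have /short_exactE[_ _ h _ _] := hv i.
  by have [x _ <-] := h y (memvf y) gy; exists x.
- move=> i z; have /short_exactE[_ _ _ _ h] := hv i.
  by have [y _ <-] := h z (memvf z); exists y.
split=> a i j.
  move=> x x' yy'; move: (relx_tail yy') (relx_head yy') => ei ej.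
  case: i / ei x yy' => x; case: j / ej x' => x' yy'.
  have /short_exactE[_ h2 h3 _ _] := ha a.
  have [||[x1 x1'] xx1] := h3 (f _ x, f _ x').
  - exact/relxE.
  - rewrite pair_lfunE /=; apply: (congr2 pair).
      by have /short_exactE[_ h _ _ _] := hv (tail_of a); case: (h x (memvf x)).
    by have /short_exactE[_ h _ _ _] := hv (head_of a); case: (h x' (memvf x')).
  rewrite pair_lfunE => e; apply/relxE.
  have inj i (u v : X i) : f i u = f i v -> u = v.
    by move=> uv; apply/eqP; rewrite -subr_eq0; apply/eqP/finj; rewrite lfunB uv subrr.
  by rewrite -(inj _ _ _ (congr1 fst e)) -(inj _ _ _ (congr1 snd e)).
move=> z z' zz'; move: (relx_tail zz') (relx_head zz') => ei ej.
case: i / ei z zz' => z; case: j / ej z' => z' /relxE zz'.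
have /short_exactE[_ _ _ _ h] := ha a.
have [[y y'] yy' e] := h _ zz'; exists y, y'; split; first exact/relxE.
  by have := congr1 fst e; rewrite pair_lfunE.
by have := congr1 snd e; rewrite pair_lfunE.
Qed.

Lemma extension_exact Z X (c : cocycle Z X) : exact_seq (ext_inj c) (ext_proj c).
Proof.
apply/exact_seqE; split.
- by move=> i x; rewrite ext_injE => /(congr1 fst).
- by move=> i x; rewrite ext_projE ext_injE.
- by move=> i [x z]; rewrite ext_projE /= => ->; exists x; rewrite ext_injE.
- by move=> i z; exists (0, z); rewrite ext_projE.
split=> a i j; first by move=> x x'; rewrite !ext_injE => /relx_ext[_]; rewrite !coc00 !subr0.
move=> z z' zz'; exists (coc c a z z', z), (coc c (star a) z' z, z'); rewrite !ext_projE.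
split=> //; apply/relx_ext; split=> //; rewrite !subrr.
by apply: relx0; [exact: relx_tail zz' | exact: relx_head zz'].
Qed.

Lemma exact_section (V W : vectType K) (g : 'Hom(V, W)) :
  exists s : 'Hom(W, V), forall y, g (s (g y)) = g y.
Proof.
exists (g^-1)%VF => y; apply: limg_lfunVK; exact: memv_img (memvf y).
Qed.

(** If [u : Z -> W] does not lift along [g : Y -> W], then vertexwise lifts [s] of
    [u] and relationwise lifts [l] of [u] differ by a cocycle with values in the
    kernel of [g]; a splitting of it would correct [s] to a lift.  The lifts at
    [a] and [star a] must agree up to swapping, so they are chosen at positive
    arrows only. *)
Lemma nonprojective_nonsplit Z : ~ rel_projective Z ->
  exists X (c : cocycle Z X), ~ split c.
Proof.
move=> Zproj; apply: NNPP => nex; apply: Zproj => X Y W f g fg u.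
have all_split (c : cocycle Z X) : split c by apply: NNPP => nc; apply: nex; exists X, c.
have {fg}[finj gf ker gsurj [krel grel]] := proj1 (exact_seqE f g) fg.
have /(_ _)/constructive_indefinite_description sg i := exact_section (g i).
have /(_ _)/constructive_indefinite_description sf i := exact_section (f i).
pose s i : 'Hom(Z i, Y i) := (sval (sg i) \o u i)%VF.
have sE i z : g i (s i z) = u i z.
  by rewrite comp_lfunE; have [y <-] := gsurj i (u i z); apply: (svalP (sg i)).
pose k i : 'Hom(Y i, X i) := sval (sf i).
have kE i y : g i y = 0 -> f i (k i y) = y by move=> /ker[x <-]; apply: (svalP (sf i)).
pose Pl a (p : (Z (tail_of a) * Z (head_of a))%type) (q : (Y (tail_of a) * Y (head_of a))%type) :=
  [/\ relx a q.1 q.2, g _ q.1 = u _ p.1 & g _ q.2 = u _ p.2].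
have Pl_lin a : lin_closed (fun p => Pl a p.1 p.2).
  split=> [|b p q [pR p1 p2] [qR q1 q2]]; first by split; rewrite /= ?lfun0 //; apply: relx0.
  by split; rewrite /= ?lfun_lin ?p1 ?p2 ?q1 ?q2 //; apply: relxP.
have /(_ _)/constructive_indefinite_description l a := linear_section (Pl_lin a).
have lP a (z : Z (tail_of a)) (z' : Z (head_of a)) :
    relx a z z' -> Pl a (z, z') (sval (l a) (z, z')).
  move=> /(hom_relx u)/grel[y [y' [yy' e e']]].
  by apply: (svalP (l a) (z, z') (y, y')).
pose m a : 'Hom(ambient2 Z, ambient2 Y) :=
  (pair_lfun (into_ambient Y (tail_of a)) (into_ambient Y (head_of a)) \o
    (sval (l a) \o pair_lfun (from_ambient Z (tail_of a)) (from_ambient Z (head_of a))))%VF.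
have mP a i j (z : Z i) (z' : Z j) : relx a z z' ->
  exists y y', [/\ relx a y y', g i y = u i z, g j y' = u j z' &
    m a (into_ambient Z i z, into_ambient Z j z') = (into_ambient Y i y, into_ambient Y j y')].
  move=> zz'; move: (relx_tail zz') (relx_head zz') => ei ej.
  case: i / ei z zz' => z; case: j / ej z' => z' /lP.
  rewrite !comp_lfunE !pair_lfunE /= !into_ambientK.
  by case: (sval (l a) (z, z')) => y y' [yy' e e']; exists y, y'.
(* [m a] lifts [u] on the relation at [a]; [n] makes this choice compatible with
   swapping. *)
pose n a : 'Hom(ambient2 Z, ambient2 Y) :=
  if positive a then m a else (swap2 Y \o (m (star a) \o swap2 Z))%VF.
have nswap a p : n (star a) (swap2 Z p) = swap2 Y (n a p).
  rewrite /n positive_star starK; case: (positive a) => /=.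
    by rewrite !comp_lfunE -[swap2 Z (swap2 Z p)]comp_lfunE swap2K id_lfunE.
  by rewrite !comp_lfunE -[swap2 Y (swap2 Y _)]comp_lfunE swap2K id_lfunE.
have nP a i j (z : Z i) (z' : Z j) : relx a z z' ->
  exists y y', [/\ relx a y y', g i y = u i z, g j y' = u j z' &
    n a (into_ambient Z i z, into_ambient Z j z') = (into_ambient Y i y, into_ambient Y j y')].
  move=> zz'; rewrite /n; case: (positive a); first exact: mP.
  have [y [y' [yy' e e' mE]]] := mP _ _ _ _ _ (relx_swap zz').
  exists y', y; split=> //; first exact/relx_star.
  by rewrite 2!comp_lfunE swap2E mE swap2E.
pose c : cocycle Z X := [ffun a => (into_ambient X (tail_of a) \o (k (tail_of a) \o
  ((s (tail_of a) \o (from_ambient Z (tail_of a) \o fst_lfun (ambient Z) (ambient Z))) -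
   (from_ambient Y (tail_of a) \o (fst_lfun (ambient Y) (ambient Y) \o n a)))))%VF].
have cE a i j (z : Z i) (z' : Z j) y y' : tail_of a = i ->
    n a (into_ambient Z i z, into_ambient Z j z') = (into_ambient Y i y, y') ->
    coc c a z z' = k i (s i z - y).
  move=> e; case: i / e z y => z y nE.
  rewrite /coc ffunE !comp_lfunE into_ambientK add_lfunE opp_lfunE !comp_lfunE nE.
  by rewrite !fst_lfunE !into_ambientK.
have [t tc] := all_split c.
pose v i : 'Hom(Z i, Y i) := s i - (f i \o t i)%VF.
have vE i z : v i z = s i z - f i (t i z) by rewrite add_lfunE opp_lfunE comp_lfunE.
have vR a i j (z : Z i) (z' : Z j) : relx a z z' -> relx a (v i z) (v j z').
  move=> zz'; have [y [y' [yy' e e' nE]]] := nP _ _ _ _ _ zz'.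
  have := tc _ _ _ _ _ zz'; rewrite (cE _ _ _ _ _ _ _ (relx_tail zz') nE).
  rewrite (cE (star a) _ _ _ _ y' (into_ambient Y i y)); last first.
  - by rewrite -[X in n _ X]swap2E nswap nE swap2E.
  - by rewrite tail_of_star; apply: relx_head zz'.
  move=> /(hom_relx f); rewrite (lfunB (f i)) (lfunB (f j)) !kE ?lfunB ?sE ?e ?e' ?subrr // => R.
  have cancel (V : zmodType) (p q r : V) : p - (q - (r - p)) = r - q.
    by rewrite opprB addrA [p + _]addrC subrK.
  by have := relxB yy' R; rewrite !vE !cancel.
exists (mk_hom vR); apply/hom_eqE => i z.
by rewrite comphE [mk_hom vR i z]vE lfunB gf subr0 sE.
Qed.

End ExactSequences.

(** * Almost split sequences with a given right end *)

Section AlmostSplit.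
Variables (K : fieldType) (E : equippedGraph).
Implicit Types X Y Z M I : rep K E.

Section Exact.
Variables (X Y Z : rep K E) (f : hom X Y) (g : hom Y Z).
Hypothesis fg : exact_seq f g.

Lemma exact_kernel M (h : hom M Y) : (forall i x, g i (h i x) = 0) ->
  exists v : hom M X, forall i x, f i (v i x) = h i x.
Proof.
have [_ _ ker _ [krel _]] := proj1 (exact_seqE f g) fg => gh.
have /(_ _)/constructive_indefinite_description sf i := exact_section (f i).
pose v i : 'Hom(M i, X i) := (sval (sf i) \o h i)%VF.
have vE i x : f i (v i x) = h i x.
  by rewrite comp_lfunE; have [y <-] := ker _ _ (gh i x); apply: (svalP (sf i)).
have vR a i j (x : M i) (x' : M j) : relx a x x' -> relx a (v i x) (v j x').
  by move=> xx'; apply: krel; rewrite !vE; apply: hom_relx.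
by exists (mk_hom vR).
Qed.

Lemma exact_cokernel M (h : hom Y M) : (forall i x, h i (f i x) = 0) ->
  exists v : hom Z M, forall i y, v i (g i y) = h i y.
Proof.
have [_ _ ker gsurj [_ grel]] := proj1 (exact_seqE f g) fg => hf.
have /(_ _)/constructive_indefinite_description sg i := exact_section (g i).
pose v i : 'Hom(Z i, M i) := (h i \o sval (sg i))%VF.
have vE i y : v i (g i y) = h i y.
  rewrite comp_lfunE; apply/eqP; rewrite -subr_eq0 -lfunB; apply/eqP.
  have [x <-] : exists x, f i x = sval (sg i) (g i y) - y.
    by apply: ker; rewrite lfunB (svalP (sg i)) subrr.
  exact: hf.
have vR a i j (z : Z i) (z' : Z j) : relx a z z' -> relx a (v i z) (v j z').
  by move=> /grel[y [y' [yy' <- <-]]]; rewrite !vE; apply: hom_relx.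
by exists (mk_hom vR).
Qed.

(** The power [u^n] has values in the image of [f] and is the identity on it. *)
Lemma exact_nilpotent_split (u : hom Y Y) (w : hom Z Z) n :
    (forall i x, u i (f i x) = f i x) -> (forall i y, g i (u i y) = w i (g i y)) ->
  (forall i z, iter n (w i) z = 0) -> split_mono f.
Proof.
have [finj _ _ _ _] := proj1 (exact_seqE f g) fg => uf gu w0.
have gun m i y : g i (iter m (u i) y) = iter m (w i) (g i y).
  by elim: m => //= m IHm; rewrite gu IHm.
have [|v vE] := exact_kernel (h := hom_iter u n) _; first by move=> i y; rewrite hom_iterE gun w0.
apply/split_monoE; exists v => i x; apply/eqP; rewrite -subr_eq0; apply/eqP/finj.
rewrite lfunB vE hom_iterE; apply/eqP; rewrite subr_eq0; apply/eqP.
by elim: (n) => //= m ->; rewrite uf.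
Qed.

Lemma exact_left_minimal : indecomposable Z -> ~ split_mono f -> left_minimal f.
Proof.
have [finj gf ker gsurj _] := proj1 (exact_seqE f g) fg => Zi nf u /hom_eqE uf.
have {}uf i x : u i (f i x) = f i x by rewrite -comphE uf.
have [|w wE] := exact_cokernel (h := comph g u) _; first by move=> i x; rewrite comphE uf gf.
have {}wE i y : g i (u i y) = w i (g i y) by rewrite wE comphE.
have [/iso_injective winj|[n wn]] := fitting w Zi; last first.
  by case: nf; apply: exact_nilpotent_split uf wE wn.
apply: injective_endo_iso => i y uy.
have [x xy] : exists x, f i x = y by apply: ker; apply: winj; rewrite -wE uy lfun0.
by rewrite -xy -(uf i x) xy uy.
Qed.

Lemma exact_right_minimal : indecomposable X -> ~ split_epi g -> right_minimal g.
Proof.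
have [finj gf ker gsurj _] := proj1 (exact_seqE f g) fg => Xi ng u /hom_eqE gu.
have {}gu i y : g i (u i y) = g i y by rewrite -comphE gu.
have [|v vE] := exact_kernel (h := comph u f) _; first by move=> i x; rewrite comphE gu gf.
have {}vE i x : f i (v i x) = u i (f i x) by rewrite vE comphE.
have [/iso_injective vinj|[n vn]] := fitting v Xi; last first.
  case: ng; have fvn m i x : f i (iter m (v i) x) = iter m (u i) (f i x).
    by elim: m => //= m IHm; rewrite vE IHm.
  have [|t tE] := exact_cokernel (h := hom_iter u n) _.
    by move=> i x; rewrite hom_iterE -fvn vn lfun0.
  apply/split_epiE; exists t => i z; have [y <-] := gsurj i z.
  by rewrite tE hom_iterE; elim: (n) => //= m; rewrite gu.
apply: injective_endo_iso => i y uy.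
have [x xy] : exists x, f i x = y by apply: ker; rewrite -gu uy lfun0.
have x0 : x = 0 by apply/vinj/finj; rewrite vE xy uy.
by rewrite -xy x0 lfun0.
Qed.

End Exact.

Lemma split_epi_ext_proj Z X (c : cocycle Z X) : split_epi (ext_proj c) -> split c.
Proof.
move=> /split_epiE[t tE]; pose s i : 'Hom(Z i, X i) := (fst_lfun (X i) (Z i) \o t i)%VF.
have tsE i z : t i z = (s i z, z).
  by rewrite comp_lfunE fst_lfunE -[X in (_, X)](tE i z) ext_projE -surjective_pairing.
by exists s => a i j z z' /(hom_relx t); rewrite !tsE => /relx_ext[].
Qed.

Section Extension.
Variables (Z X : rep K E) (c : cocycle Z X).
Hypotheses (Zi : indecomposable Z) (Xi : indecomposable X) (nc : ~ split c).
Hypothesis push_split : forall M (u : hom X M), ~ split_mono u -> split (push u c).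

Let not_mono : ~ split_mono (ext_inj c).
Proof. by move/split_retract. Qed.

Lemma extension_left_almost_split : left_almost_split (ext_inj c).
Proof.
split=> // M u /push_split/ext_factor_push[h hE]; exists h; apply/hom_eqE => i x.
by rewrite comphE hE.
Qed.

(** If [u : M -> Z] does not lift, then the pulled back extension does not split,
    so its inclusion of [X] factors through the given extension.  This induces a
    map [w : Z -> M]; the endomorphism [u w] is not invertible as [u] is no split
    epimorphism, hence it is nilpotent, and the given extension splits. *)
Lemma extension_right_almost_split : right_almost_split (ext_proj c).
Proof.
split=> [/split_epi_ext_proj//|M u nu].
pose d := pull u c.
have cocd a i j (m : M i) (m' : M j) : relx a m m' ->
    coc d a m m' = coc c a (u i m) (u j m') /\
    coc d (star a) m' m = coc c (star a) (u j m') (u i m).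
  move=> mm'; have ei := relx_tail mm'; have ej := relx_head mm'.
  by rewrite !coc_pull // ?tail_of_star ?head_of_star.
case: (classic (split d)) => [[s sd]|nd].
  pose v i : 'Hom(M i, extension c i) := linfun (fun m => (s i m, u i m) : extension c i).
  have vE i m : v i m = (s i m, u i m).
    by rewrite linear_lfunE // => k m1 m2; rewrite !lfun_lin.
  have vR a i j (m : M i) (m' : M j) : relx a m m' -> relx a (v i m) (v j m').
    move=> mm'; rewrite !vE; apply/relx_ext; split; first exact: hom_relx.
    by have [<- <-] := cocd _ _ _ _ _ mm'; apply: sd.
  by exists (mk_hom vR); apply/hom_eqE => i m; rewrite comphE ext_projE [mk_hom vR i m]vE.
(* The pulled back extension maps to the given one over [u]. *)
pose k i : 'Hom(extension d i, extension c i) := pair_lfun \1%VF (u i).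
have kE i x m : k i (x, m) = (x, u i m) by rewrite pair_lfunE id_lfunE.
have kR a i j (v : extension d i) (w : extension d j) : relx a v w -> relx a (k i v) (k j w).
  case: v w => [x m] [x' m'] /relx_ext[mm' xx']; rewrite !kE; apply/relx_ext.
  by have [<- <-] := cocd _ _ _ _ _ mm'; split=> //; apply: hom_relx.
pose kh := mk_hom kR.
have [|h /hom_eqE hE] := proj2 extension_left_almost_split _ (ext_inj d).
  by move/split_retract.
have {}hE i x : h i (ext_inj c i x) = ext_inj d i x by rewrite -comphE hE.
have [|w wE] := exact_cokernel (extension_exact c) (h := comph (ext_proj d) h) _.
  by move=> i x; rewrite comphE hE ext_projE ext_injE.
have [/is_isoE[t [_ uwt]]|[n uwn]] := fitting (comph u w) Zi.
  by case: nu; apply/split_epiE; exists (comph w t) => i z; rewrite comphE -[RHS](uwt i z) comphE.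
case: not_mono; apply: (exact_nilpotent_split (extension_exact c) (u := comph kh h) _ _ uwn).
  by move=> i x; rewrite comphE hE !ext_injE; apply: (etrans (kE _ _ _)); rewrite lfun0.
move=> i y; rewrite !comphE wE comphE; case: (h i y) => x m.
by rewrite [kh i _]kE !ext_projE.
Qed.

Lemma extension_AR : AR_sequence (ext_inj c) (ext_proj c).
Proof.
split; first exact: extension_exact.
  split; last exact: extension_left_almost_split.
  exact: exact_left_minimal (extension_exact c) Zi not_mono.
split; last exact: extension_right_almost_split.
by apply: (exact_right_minimal (extension_exact c) Xi) => /split_epi_ext_proj.
Qed.

End Extension.

End AlmostSplit.

(** * Existence of almost split classes *)

Section Existence.
Variables (K : fieldType) (E : equippedGraph) (Z : rep K E).
Implicit Types X Y M I : rep K E.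

Definition form I (p : forall i, 'Hom(I i, extdual_sort Z)) X (h : hom X I) :
    'Hom(cocycle Z X, K^o) :=
  pairing (fun i => (p i \o h i)%VF).

Section Form.
Variables (I : rep K E) (p : forall i, 'Hom(I i, extdual_sort Z)).

Lemma form_lin X k (h h1 h2 : hom X I) c : (forall i x, h i x = k *: h1 i x + h2 i x) ->
  form p h c = k *: form p h1 c + form p h2 c.
Proof.
by move=> hE; apply: pairing_lin => i x; rewrite !comp_lfunE hE lfun_lin.
Qed.

Lemma form_add X (h h1 h2 : hom X I) c : (forall i x, h i x = h1 i x + h2 i x) ->
  form p h c = form p h1 c + form p h2 c.
Proof.
by move=> hE; rewrite (@form_lin X 1 h h1 h2) ?scale1r // => i x; rewrite scale1r.
Qed.

Lemma form_eq X (h h' : hom X I) c : (forall i x, h i x = h' i x) -> form p h c = form p h' c.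
Proof. by move=> hh'; apply: pairing_eq => i x; rewrite !comp_lfunE hh'. Qed.

Lemma form0 X (h : hom X I) c : (forall i x, h i x = 0) -> form p h c = 0.
Proof.
move=> h0; rewrite (@form_lin X (-1) h h h) ?scaleN1r ?addNr // => i x.
by rewrite !h0 scaler0 addr0.
Qed.

Lemma form_push X Y (f : hom X Y) (h : hom Y I) c :
  form p h (push f c) = form p (comph h f) c.
Proof. by rewrite /form pairing_push; apply: pairing_eq => i x; rewrite !comp_lfunE. Qed.

End Form.

(** Weaker than being a right approximation of [extdual Z]: only the induced
    forms have to agree.  In this form the property passes to the complement of
    a superfluous summand of [I]. *)
Definition generates I (p : forall i, 'Hom(I i, extdual_sort Z)) : Prop :=
  prehom (M := extdual Z) p /\ forall X t, prehom (X := X) (M := extdual Z) t ->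
    exists h : hom X I, forall c, pairing t c = form p h c.

Definition almost_split_class X (c : cocycle Z X) : Prop :=
  ~ split c /\ forall M (u : hom X M), ~ split_mono u -> split (push u c).

Lemma prehom_comp M X Y (N : prerep K E) (t : forall i, 'Hom(Y i, presort N)) (h : hom X Y) :
  prehom t -> prehom (fun i => (t i \o h i)%VF).
Proof.
move=> [tS tR]; split=> [i x|a i j v w vw]; rewrite !comp_lfunE; first exact: tS.
by apply: tR; apply: hom_relx.
Qed.

(** The maps [I1 -> I] that are not split monomorphisms form a subspace, as [I1]
    has a local endomorphism ring.  If no nonsplit class is killed by all of
    them, then [i1] induces the same forms as one of them, [r].  As [p1 r] is
    nilpotent, substituting [r = i1 (p1 r) + i2 (p2 r)] into itself often enough
    expresses the forms of [i1] by maps through [I2]. *)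
Lemma generates_almost_split I p (I1 I2 : rep K E) (i1 : hom I1 I) (i2 : hom I2 I)
    (p1 : hom I I1) (p2 : hom I I2) :
    @generates I p -> direct_sum i1 i2 p1 p2 -> indecomposable I1 ->
  (exists c : cocycle Z I1, almost_split_class c) \/ generates (fun i => (p i \o i2 i)%VF).
Proof.
move=> [pM pgen] [h11 h22 h12 h21 hsum] I1i.
(* As [I1] is indecomposable, these maps form the radical of [Hom(I1, I)]. *)
pose radical (g : hom I1 I) := ~ split_mono g.
case: (classic (exists c : cocycle Z I1,
    ~ split c /\ forall g, radical g -> form p g c = 0)) => [[c [nc c0]]|nex].
  left; exists c; split=> // M u nu; apply: NNPP => /pairing_separates[t [tM]].
  have [h ->] := pgen _ _ tM; rewrite form_push; apply; apply: c0 => /split_monoE[r rE].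
  by apply: nu; apply/split_monoE; exists (comph r h) => i x; rewrite comphE -[RHS]rE comphE.
right.
have rad0 c : (forall g, radical g -> form p g c = 0) -> form p i1 c = 0.
  move=> c0; apply: pairing_split; first exact: prehom_comp.
  by apply: NNPP => nc; apply: nex; exists c.
pose G := vset (fun L => exists2 g, radical g & L = form p g).
have G_lin : lin_closed (fun L => exists2 g, radical g & L = form p g).
  split=> [|k _ _ [g gr ->] [g' g'r ->]].
    exists (zeroh I1 I); last first.
      by apply/lfunP => c; rewrite zero_lfunE form0 // => i x; apply: zero_lfunE.
    move=> /split_monoE[r rE]; case: I1i => nz _; apply: nz; apply/zero_objectE => i x.
    by rewrite -(rE i x) [zeroh I1 I i x]zero_lfunE lfun0.
  exists (lin_hom k g g'); last first.
    apply/lfunP => c; rewrite add_lfunE scale_lfunE.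
    by apply/esym/form_lin => i x; rewrite lin_homE.
  move=> /split_monoE[r rE].
  have sub h : radical h -> ~ is_iso (comph r h).
    move=> hr /is_isoE[s [sE _]]; apply: hr; apply/split_monoE; exists (comph s r) => i x.
    by rewrite comphE -[RHS](sE i x) comphE.
  apply: (indecomposable_local (k := k) I1i (sub _ gr) (sub _ g'r)); apply/is_isoE.
  by exists (idh I1); split=> i x; rewrite !idhE lin_homE !comphE -lfun_lin -lin_homE rE.
have : form p i1 \in G.
  apply: bidual_span => c c0; apply: rad0 => g gr; apply: c0.
  by apply/(mem_vset G_lin); exists g.
move=> /(mem_vset G_lin)[r rr /lfunP i1r].
pose r1 := comph p1 r; pose r2 := comph p2 r.
have [/is_isoE[s [sE _]]|[n r1n]] := fitting r1 I1i.
  by case: rr; apply/split_monoE; exists (comph s p1) => i x; rewrite comphE -[RHS](sE i x) comphE.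
have [q qE] : exists q : hom I1 I2, forall c, form p i1 c = form p (comph i2 q) c.
  suff step m : exists q : hom I1 I2, forall c,
      form p i1 c = form p (comph i1 (hom_iter r1 m)) c + form p (comph i2 q) c.
    have [q qE] := step n; exists q => c; rewrite qE form0 ?add0r // => i x.
    by rewrite comphE hom_iterE r1n lfun0.
  elim: m => [|m [q qE]].
    exists (zeroh I1 I2) => c; rewrite [X in _ + X]form0 ?addr0.
      by apply: form_eq => i x; rewrite comphE idhE.
    by move=> i x; rewrite comphE [zeroh _ _ _ _]zero_lfunE lfun0.
  pose s := hom_iter r1 m; exists (lin_hom 1 (comph r2 s) q) => c.
  rewrite qE -form_push i1r form_push.
  rewrite (@form_add _ p _ (comph r s) (comph i1 (comph r1 s)) (comph i2 (comph r2 s))); last first.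
    by move=> i x; rewrite !comphE hsum.
  rewrite -addrA; congr (_ + _); apply/esym/form_add => i x.
  by rewrite !comphE lin_homE scale1r lfunD !comphE.
split=> [|X t /pgen[h hE]]; first exact: prehom_comp.
exists (lin_hom 1 (comph q (comph p1 h)) (comph p2 h)) => c; rewrite hE.
rewrite (@form_add _ p _ h (comph i1 (comph p1 h)) (comph i2 (comph p2 h))); last first.
  by move=> i x; rewrite !comphE hsum.
rewrite -form_push qE form_push.
transitivity (form p (comph i2 (lin_hom 1 (comph q (comph p1 h)) (comph p2 h))) c).
  apply/esym/form_add => i x; rewrite !comphE lin_homE scale1r lfunD.
  by rewrite !comphE.
by apply: pairing_eq => i x; rewrite !comp_lfunE.
Qed.

Lemma exists_almost_split_class : no_cycle_outside_Omega E ->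
    (exists X (c : cocycle Z X), ~ split c) ->
  exists X (c : cocycle Z X), indecomposable X /\ almost_split_class c.
Proof.
move=> /(right_approximation (extdual Z))[I [p [pM pL]]] [X0 [c0 nc0]].
have pgen : generates p.
  split=> // X t /pL[h hE]; exists h => c; apply: pairing_eq => i x.
  by rewrite comp_lfunE hE.
have [n] := ubnP (rdim I); elim: n I p {pM pL} pgen => // n IHn I p pgen ltIn.
have I0 : ~ zero_object I.
  move=> /zero_objectE I0; have [t [tM]] := pairing_separates nc0.
  by have [h ->] := proj2 pgen _ _ tM; apply; apply: form0 => i x; apply: I0.
have [I1 [i1 [p1 [pi1 I1i]]]] := indecomposable_retract I0.
have [I2 [i2 [p2 sum]]] := retract_direct_sum pi1.
have [[c cs]|gen2] := generates_almost_split pgen sum I1i; first by exists I1, c.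
by apply: IHn gen2 (leq_trans (direct_sum_rdim sum (proj1 I1i)) ltIn).
Qed.

Lemma AR_sequence_ending : no_cycle_outside_Omega E ->
    indecomposable Z -> ~ rel_projective Z ->
  exists X Y (f : hom X Y) (g : hom Y Z), AR_sequence f g.
Proof.
move=> nocycle Zi /nonprojective_nonsplit/(exists_almost_split_class nocycle).
move=> [X [c [Xi [nc push_split]]]]; exists X, (extension c), (ext_inj c), (ext_proj c).
exact: extension_AR.
Qed.

End Existence.

(** * Duality *)

(** The graph is unpacked, so that complementing [Omega] twice gives back the
    same graph up to conversion. *)
Section Dual.
Variables (K : fieldType) (V A : finType) (hd tl : A -> V) (st : A -> A).
Hypotheses (stK : involutive st) (st_neq : forall a, st a != a)
  (hd_st : forall a, hd (st a) = tl a).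

Definition graph (O : {set A}) : equippedGraph :=
  {| starK := stK; star_neq := st_neq; head_of_star := hd_st; Omega := O |}.

Definition linear_dual (W : vectType K) : vectType K := 'Hom(W, K^o).

Definition dual_rel O (X : rep K (graph O)) (a : A) i j
    (l : linear_dual (X i)) (m : linear_dual (X j)) : Prop :=
  forall (x : X i) (x' : X j), relx (X := X) a x x' -> l x + m x' = 0.

Section DualRep.
Variables (O O' : {set A}).
Hypothesis OO' : forall a, (a \in O') = (a \notin O).
Implicit Types X Y Z : rep K (graph O).

(** Annihilators exchange everywhere defined relations with those of trivial
    kernel. *)
Lemma dual_family (X : rep K (graph O)) :
  @relation_family K (graph O') (fun i => linear_dual (X i)) (@dual_rel O X).
Proof.
split=> [a|a i j l m _ _ lm|a i j l ei ej pa|a i j l ei ej pa l0].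
- split=> [x x' _|k u v uR vR x x' xx']; first by rewrite !zero_lfunE addr0.
  rewrite /= !add_lfunE !scale_lfunE addrACA -scalerDr.
  by rewrite (uR _ _ xx') (vR _ _ xx') scaler0 addr0.
- by move=> x x' /relx_swap; rewrite starK addrC => /lm.
- case: i / ei l => l; case: j / ej.
  have [|f fP] := relx_inverse X (a := a); first by rewrite /phi -OO'.
  exists (- (l \o f))%VF => x x' xx'.
  by rewrite opp_lfunE comp_lfunE (fP _ _ xx') subrr.
apply/lfunP => x; rewrite zero_lfunE.
have [|x' xx'] := relx_def (X := X) (a := a) x _ ei ej; first by move: pa; rewrite /phi OO' negbK.
by have := l0 _ _ xx'; rewrite zero_lfunE addr0.
Qed.

Definition dual_rep X : rep K (graph O') := mk_rep (dual_family X).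

Lemma relx_dual X a i j (l : dual_rep X i) (m : dual_rep X j) : tl a = i -> hd a = j ->
  relx (X := dual_rep X) a l m <-> dual_rel (X := X) a l m.
Proof. by move=> ei ej; rewrite relx_mk; split=> [[]|]. Qed.

Lemma relx_dual0 X a i j (l : dual_rep X i) (m : dual_rep X j) (x : X i) (x' : X j) :
  relx (X := dual_rep X) a l m -> relx (X := X) a x x' -> l x + m x' = 0.
Proof. by move=> lm xx'; have /relx_mk[_ _ lm'] := lm; apply: lm'. Qed.

Lemma dual_separates (W : vectType K) (x y : W) : (forall l : 'Hom(W, K^o), l x = l y) -> x = y.
Proof.
move=> lxy; apply/eqP; rewrite -subr_eq0 -memv0; apply/negPn/negP => /separation[l [_]].
by rewrite lfunB lxy subrr => /esym/eqP; rewrite oner_eq0.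
Qed.

(** The relation is the annihilator of its annihilator. *)
Lemma relx_bidual X a i j (x : X i) (x' : X j) : tl a = i -> hd a = j ->
    (forall (l : dual_rep X i) (m : dual_rep X j),
       relx (X := dual_rep X) a l m -> l x + m x' = 0) ->
  relx (X := X) a x x'.
Proof.
move=> ei ej; case: i / ei x => x; case: j / ej x' => x' lm0.
apply/relxE; apply/negPn/negP => /separation[L [LX L1]].
pose l : dual_rep X (tl a) := (L \o inl_lfun _ _)%VF.
pose m : dual_rep X (hd a) := (L \o inr_lfun _ _)%VF.
have LE y y' : L (y, y') = l y + m y'.
  rewrite /l /m !comp_lfunE inl_lfunE inr_lfunE -lfunD; congr (L _).
  by congr pair; rewrite /= ?addr0 ?add0r.
have /lm0 : relx (X := dual_rep X) a l m.
  by apply/relx_dual => // y y' /relxE yy'; rewrite -LE LX.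
by rewrite -LE L1 => /eqP; rewrite oner_eq0.
Qed.

(** By reflexivity of finite-dimensional spaces and relations, a map into [X] is
    the same as a bilinear pairing with the dual of [X] that respects the
    relations. *)
Lemma represent (X Y : rep K (graph O)) (b : forall i, Y i -> dual_rep X i -> K^o) :
    (forall i y, linear (b i y)) -> (forall i l, linear (fun y => b i y l)) ->
    (forall a i j (y : Y i) (y' : Y j) (l : dual_rep X i) (m : dual_rep X j),
       relx (X := Y) a y y' -> relx (X := dual_rep X) a l m -> b i y l + b j y' m = 0) ->
  exists v : hom Y X, forall i y (l : dual_rep X i), l (v i y) = b i y l.
Proof.
move=> bl by_ b0.
have ex i : exists v : 'Hom(Y i, X i), forall y (l : dual_rep X i), l (v y) = b i y l.
  pose P y x := forall l : dual_rep X i, l x = b i y l.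
  have Plin : lin_closed (fun p : (Y i * X i)%type => P p.1 p.2).
    split=> [l|k p q pR qR l] /=; last by rewrite lfun_lin by_ pR qR.
    have e : (0 : Y i) = -1 *: 0 + 0 by rewrite scaler0 addr0.
    have b0l : b i 0 l = 0.
      by rewrite e; apply: (etrans (by_ i l (-1) 0 0)); rewrite scaleN1r addNr.
    exact: etrans (lfun0 l) (esym b0l).
  have [v vP] := linear_section Plin; exists v => y.
  have [x xE] := bidual (linfun (b i y)).
  by apply: (vP y x) => l; apply: (etrans (esym (xE l))); apply: linear_lfunE (bl i y) l.
have /(_ _)/constructive_indefinite_description ex' := ex.
pose v i := sval (ex' i); have vE i y (l : dual_rep X i) : l (v i y) = b i y l := svalP (ex' i) y l.
have vR a i j (y : Y i) (y' : Y j) : relx (X := Y) a y y' -> relx (X := X) a (v i y) (v j y').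
  move=> yy'; apply: relx_bidual => [||l m lm].
  - exact: relx_tail yy'.
  - exact: relx_head yy'.
  by rewrite !vE; apply: b0 yy' lm.
by exists (mk_hom vR).
Qed.

Lemma transpose (X Y : rep K (graph O)) (f : hom X Y) :
  exists g : hom (dual_rep Y) (dual_rep X), forall i (l : dual_rep Y i) x, g i l x = l (f i x).
Proof.
pose g i : 'Hom(dual_rep Y i, dual_rep X i) :=
  linfun (fun l : dual_rep Y i => (l \o f i)%VF : dual_rep X i).
have gE i (l : dual_rep Y i) x : g i l x = l (f i x).
  rewrite linear_lfunE ?comp_lfunE // => k u v; apply/lfunP => y.
  by rewrite add_lfunE scale_lfunE !comp_lfunE add_lfunE scale_lfunE.
have gR a i j (l : dual_rep Y i) (m : dual_rep Y j) :
      relx (X := dual_rep Y) a l m -> relx (X := dual_rep X) a (g i l) (g j m).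
  move=> lm; apply/relx_dual => [||x x' xx']; [exact: relx_tail lm | exact: relx_head lm|].
  by rewrite !gE; apply: relx_dual0 lm _; apply: hom_relx.
by exists (mk_hom gR).
Qed.

(** The lift of a pair of forms in the relation of the dual of [X] is a
    form on pairs over [Y] that extends it and vanishes on the relation of [Y];
    it exists because that relation meets the image of [X] in the relation of
    [X]. *)
Lemma transpose_exact (X Y Z : rep K (graph O)) (f : hom X Y) (g : hom Y Z)
    (f' : hom (dual_rep Y) (dual_rep X)) (g' : hom (dual_rep Z) (dual_rep Y)) :
    exact_seq f g ->
    (forall i (l : dual_rep Y i) x, f' i l x = l (f i x)) ->
    (forall i (l : dual_rep Z i) x, g' i l x = l (g i x)) ->
  exact_seq g' f'.
Proof.
move=> /exact_seqE[finj gf ker gsurj [krel grel]] f'E g'E; apply/exact_seqE; split.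
- move=> i l l0; apply/lfunP => z; have [y <-] := gsurj i z.
  by rewrite -g'E l0 !zero_lfunE.
- by move=> i l; apply/lfunP => x; rewrite f'E g'E gf lfun0 zero_lfunE.
- move=> i m m0; have [s sE] := exact_section (g i).
  exists (m \o s)%VF; apply/lfunP => y; rewrite g'E comp_lfunE.
  apply/eqP; rewrite -subr_eq0 -lfunB.
  have [x <-] : exists x, f i x = s (g i y) - y by apply: ker; rewrite lfunB sE subrr.
  by rewrite -f'E m0 zero_lfunE.
- move=> i l; have [s sE] := exact_section (f i); exists (l \o s)%VF; apply/lfunP => x.
  rewrite f'E comp_lfunE; congr (l _); apply/eqP; rewrite -subr_eq0; apply/eqP/finj.
  by rewrite lfunB sE subrr.
split=> a i j.
  move=> n n' nn'; apply/relx_dual => [||z z' zz'].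
  - exact: relx_tail nn'.
  - exact: relx_head nn'.
  have [y [y' [yy' <- <-]]] := grel _ _ _ _ _ zz'.
  by rewrite -!g'E; apply: relx_dual0 nn' yy'.
move=> l l' ll'; move: (relx_tail ll') (relx_head ll') => /= ei ej.
case: i / ei l ll' => l; case: j / ej l' => l' ll'.
pose F := pair_lfun (f (tl a)) (f (hd a)).
pose L : 'Hom((X (tl a) * X (hd a))%type, K^o) :=
  ((l \o fst_lfun (X (tl a)) (X (hd a))) + (l' \o snd_lfun (X (tl a)) (X (hd a))))%VF.
have LE x x' : L (x, x') = l x + l' x'.
  by rewrite add_lfunE !comp_lfunE fst_lfunE snd_lfunE.
have [[x x']|M [MF MY]] := @functional_extension K _ _ F (relat Y a) L.
  rewrite pair_lfunE LE => /relxE/krel; exact: relx_dual0 ll'.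
pose m : dual_rep Y (tl a) := (M \o inl_lfun (Y (tl a)) (Y (hd a)))%VF.
pose m' : dual_rep Y (hd a) := (M \o inr_lfun (Y (tl a)) (Y (hd a)))%VF.
have ME y y' : M (y, y') = m y + m' y'.
  rewrite /m /m' !comp_lfunE inl_lfunE inr_lfunE -lfunD; congr (M _).
  by congr pair; rewrite /= ?addr0 ?add0r.
exists m, m'; split.
- by apply/relx_dual => // y y' /relxE yy'; rewrite -ME MY.
- apply/lfunP => x; rewrite f'E /m comp_lfunE inl_lfunE.
  by have := MF (x, 0); rewrite LE pair_lfunE /= !lfun0 addr0 => <-.
apply/lfunP => x; rewrite f'E /m' comp_lfunE inr_lfunE.
by have := MF (0, x); rewrite LE pair_lfunE /= !lfun0 add0r => <-.
Qed.

Lemma dual_full (X Y : rep K (graph O)) (w : hom (dual_rep X) (dual_rep Y)) :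
  exists v : hom Y X, forall i y (l : dual_rep X i), l (v i y) = w i l y.
Proof.
apply: represent => [i y k l m|i l k y z|a i j y y' l m yy' lm].
- by rewrite lfun_lin add_lfunE scale_lfunE.
- by rewrite lfun_lin.
by apply: relx_dual0 yy'; apply: hom_relx.
Qed.

(** Duality is full and faithful, so idempotents of the dual come from [X]. *)
Lemma dual_indecomposable X : indecomposable X -> indecomposable (dual_rep X).
Proof.
move=> Xi; split=> [/zero_objectE X0|A1 A2 /is_direct_sumE[i1 [i2 [p1 [p2 [h11 h22 h12 h21 h]]]]]].
  case: Xi => nX _; apply/nX/zero_objectE => i x; apply: dual_separates => l.
  by rewrite (X0 i l) !zero_lfunE.
have [v vE] := dual_full (comph i1 p1).
have [|v0|v1] := @indecomposable_idempotent _ _ X v Xi.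
- by move=> i x; apply: dual_separates => l; rewrite !vE !comphE h11.
- left; apply/zero_objectE => i y; rewrite -(h11 i y) -[in RHS](lfun0 (p1 i)); congr (p1 i _).
  apply/lfunP => x; rewrite zero_lfunE -(h11 i y) -comphE.
  by rewrite -vE v0 lfun0.
right; apply/zero_objectE => i y; rewrite -(h22 i y) -[in RHS](lfun0 (p2 i)); congr (p2 i _).
apply/lfunP => x; rewrite zero_lfunE -[in LHS](v1 i x) vE comphE h12 lfun0.
by rewrite zero_lfunE.
Qed.

End DualRep.

End Dual.

Section DualAR.
Variables (K : fieldType) (V A : finType) (hd tl : A -> V) (st : A -> A).
Hypotheses (stK : involutive st) (st_neq : forall a, st a != a)
  (hd_st : forall a, hd (st a) = tl a).

Local Notation graph O := (graph stK st_neq hd_st O).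

Section Adjunction.
Variables (O O' : {set A}).
Hypotheses (OO' : forall a, (a \in O') = (a \notin O)) (O'O : forall a, (a \in O) = (a \notin O')).
Implicit Types (X M : rep K (graph O)) (W : rep K (graph O')).

Local Notation D := (dual_rep OO').
Local Notation D' := (dual_rep O'O).

Lemma adjoint X W (g : hom W (D X)) :
  exists f : hom X (D' W), forall i x w, f i x w = g i w x.
Proof.
pose f i : 'Hom(X i, D' W i) :=
  linfun (fun x : X i => linfun (fun w : W i => g i w x) : D' W i).
have lin1 i x : linear (fun w : W i => g i w x).
  by move=> k w w'; rewrite lfun_lin add_lfunE scale_lfunE.
have fE i x w : f i x w = g i w x.
  rewrite linear_lfunE => [|k u v]; first exact: linear_lfunE (lin1 i x) w.
  apply/lfunP => y; rewrite add_lfunE scale_lfunE (linear_lfunE (lin1 i _)).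
  by rewrite (linear_lfunE (lin1 i u)) (linear_lfunE (lin1 i v)) lfun_lin.
have fR a i j (x : X i) (x' : X j) : relx (X := X) a x x' -> relx (X := D' W) a (f i x) (f j x').
  move=> xx'; apply/relx_dual => [||w w' ww'].
  - exact: relx_tail xx'.
  - exact: relx_head xx'.
  by rewrite !fE; apply: (relx_dual0 (hom_relx g ww') xx').
by exists (mk_hom fR).
Qed.

(** The correspondence for maps out of a dual, which uses reflexivity. *)
Lemma adjoint_full X W (r : hom (D' W) X) :
  exists s : hom (D X) W, forall i l (m : D' W i), m (s i l) = l (r i m).
Proof.
apply: (represent (OO' := O'O) (X := W) (Y := D X) (b := fun i l m => l (r i m)))
  => [i l k m n|i m k l n|a i j l l' m m' ll' mm'].
- by rewrite !lfun_lin.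
- by rewrite add_lfunE scale_lfunE.
exact: (relx_dual0 ll' (hom_relx r mm')).
Qed.

End Adjunction.

Section Transport.
Variables (O O' : {set A}).
Hypotheses (OO' : forall a, (a \in O') = (a \notin O)) (O'O : forall a, (a \in O) = (a \notin O')).
Implicit Types (X M : rep K (graph O)) (W : rep K (graph O')).

Local Notation D := (dual_rep OO').
Local Notation D' := (dual_rep O'O).

Lemma dual_projective X : rel_projective (D X) -> rel_injective X.
Proof.
move=> proj A1 B C f g fg u.
have [f' f'E] := transpose OO' f; have [g' g'E] := transpose OO' g.
have [u' u'E] := transpose OO' u.
have [w /hom_eqE wE] := proj _ _ _ _ _ (transpose_exact fg f'E g'E) u'.
have [v vE] := dual_full w; exists v; apply/hom_eqE => i x; apply: dual_separates => l.
by rewrite comphE vE -f'E -u'E -[in RHS]wE comphE.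
Qed.

Lemma iso_exact (E : equippedGraph) (X1 X Y Z : rep K E)
    (e : hom X1 X) (f : hom X Y) (g : hom Y Z) :
  is_iso e -> exact_seq f g -> exact_seq (comph f e) g.
Proof.
move=> /is_isoE[e' [eK e'K]] /exact_seqE[finj gf ker gsurj [krel grel]].
apply/exact_seqE; split=> // [i x|i x|i y /ker[x <-]|].
- by rewrite comphE => /finj ex; rewrite -(eK i x) ex lfun0.
- by rewrite comphE gf.
- by exists (e' i x); rewrite comphE e'K.
split=> // a i j x x'; rewrite !comphE => /krel/(hom_relx e').
by rewrite !eK.
Qed.

Lemma bidual_iso X : exists e : hom X (D' (D X)), is_iso e /\ forall i x l, e i x l = l x.
Proof.
have [e eE] := adjoint O'O (idh (D X)).
have {}eE i x l : e i x l = l x by rewrite eE idhE.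
have [e' e'E] : exists e' : hom (D' (D X)) X, forall i t (l : D X i), l (e' i t) = t l.
  apply: (represent (OO' := OO') (X := X) (Y := D' (D X)) (b := fun i t l => t l))
    => [i t k l m|i l k t u|a i j t t' l l' tt' ll'].
  - by rewrite lfun_lin.
  - by rewrite add_lfunE scale_lfunE.
  exact: (relx_dual0 tt' ll').
exists e; split=> //; apply/is_isoE; exists e'; split=> i x.
  by apply: dual_separates => l; rewrite (e'E i _ l) eE.
by apply/lfunP => l; rewrite eE (e'E i _ l).
Qed.

(** Every condition transposes: minimality through fullness of duality, and a
    test map into or out of a representation becomes, by adjunction, a test map
    for the other end of the given sequence. *)
Lemma dual_AR X W W1 (f : hom W W1) (g : hom W1 (D X)) : AR_sequence f g ->
  exists (f1 : hom X (D' W1)) (g1 : hom (D' W1) (D' W)), AR_sequence f1 g1.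
Proof.
move=> [fg [fmin [nf fas]] [gmin [ng gas]]].
have [gt gtE] := transpose O'O g; have [g1 g1E] := transpose O'O f.
have [e [eiso eE]] := bidual_iso X.
pose f1 := comph gt e; have f1E i x w : f1 i x w = g i w x.
  by rewrite comphE gtE eE.
have iso_of (u : hom (D' W1) (D' W1)) (v : hom W1 W1) :
    (forall i b (l : D' W1 i), l (v i b) = u i l b) -> is_iso v -> is_iso u.
  move=> vE /is_isoE[v' [_ v'K]]; apply: injective_endo_iso => i l ul.
  by apply/lfunP => b; rewrite -(v'K i b) vE ul !zero_lfunE.
exists f1, g1; split; first exact: iso_exact eiso (transpose_exact fg g1E gtE).
  split=> [u /hom_eqE uf|].
    have [v vE] := dual_full u; apply: (iso_of u v vE); apply: gmin.
    by apply/hom_eqE => i b; apply/lfunP => x; rewrite comphE -!f1E vE -[in RHS]uf comphE.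
  split=> [/split_monoE[r rE]|M u nu].
    have [s sE] := adjoint_full OO' r; apply: ng; apply/split_epiE; exists s => i l.
    by apply/lfunP => x; rewrite -f1E sE rE.
  have [u' u'E] := transpose OO' u.
  have [|k /hom_eqE kE] := gas _ u'.
    move=> /split_epiE[s sE]; have [v vE] := dual_full s.
    apply: nu; apply/split_monoE; exists v => i x; apply: dual_separates => l.
    by rewrite vE -u'E sE.
  have [h hE] := adjoint_full O'O k; exists h; apply/hom_eqE => i x; apply: dual_separates => l.
  by rewrite comphE hE f1E -comphE kE u'E.
split=> [u /hom_eqE gu|].
  have [v vE] := dual_full u; apply: (iso_of u v vE); apply: fmin.
  apply/hom_eqE => i b; apply: dual_separates => l.
  by rewrite comphE (vE i (f i b) l) -g1E -comphE gu g1E.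
split=> [/split_epiE[s sE]|M u nu].
  have [v vE] := dual_full s; apply: nf; apply/split_monoE; exists v => i w.
  by apply: dual_separates => l; rewrite (vE i (f i w) l) -g1E sE.
have [u' u'E] := adjoint OO' u.
have [|k /hom_eqE kE] := fas _ u'.
  move=> /split_monoE[r rE]; have [s sE] := adjoint_full O'O r.
  apply: nu; apply/split_epiE; exists s => i n; apply/lfunP => w.
  by rewrite -u'E sE rE.
have [h hE] := adjoint O'O k; exists h; apply/hom_eqE => i m; apply/lfunP => w.
by rewrite comphE g1E hE -comphE kE u'E.
Qed.

End Transport.
End DualAR.

Section ConstantCycles.
Variable E : equippedGraph.

Lemma phi_constant_all (b : bool) (w : seq (arrow E)) :
  all (fun a => phi a == b) w -> phi_constant w.
Proof.
rewrite /phi_constant; case: w => //= a w /andP[/eqP -> aw].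
by rewrite all_map; apply: sub_all aw => c /eqP /= ->.
Qed.

End ConstantCycles.

Theorem corollary5p2 (K : fieldType) (E : equippedGraph)
    (no_constant_cycle :
       forall w : seq (arrow E), oriented_cycle w -> ~~ phi_constant w) :
  has_AR_sequences K E.
Proof.
case: E no_constant_cycle => V A hd tl st stK st_neq hd_st O no_constant_cycle.
split=> [Z Zi Zproj|X Xi Xinj].
  apply: (AR_sequence_ending _ Zi Zproj) => w /no_constant_cycle; apply: contra => w0.
  by apply: (@phi_constant_all _ false); apply: sub_all w0 => a /negPf ->.
pose O' := ~: O.
have OO' a : (a \in O') = (a \notin O) by rewrite inE.
have O'O a : (a \in O) = (a \notin O') by rewrite inE negbK.
have DXi := dual_indecomposable OO' Xi.
have [||W [W1 [f [g fg]]]] := AR_sequence_ending _ DXi.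
- move=> w /no_constant_cycle; apply: contra => w0; apply: (@phi_constant_all _ true).
  by apply: sub_all w0 => a; rewrite /phi /= OO' negbK => ->.
- by move/dual_projective.
by have [f1 [g1 fg1]] := dual_AR O'O fg; exists (dual_rep O'O W1), (dual_rep O'O W), f1, g1.
Qed.
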